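(* Let $\alpha\in\mathbb{R}^+\setminus\mathbb{Q}$ and let $f\colon[0,1)\to\mathbb{R}$ be non-negative, bounded and Lebesgue measurable. For $y\in[0,1)$ let $\mu_y=\sum_{z\in\mathbb{Z}}f(T_\alpha^z(y))\,\delta_z$. Then for Lebesgue-almost every $y\in[0,1)$ the autocorrelation $\gamma_{\mu_y}$ exists, equals $\sum_{z\in\mathbb{Z}}\Xi(T_\alpha,\Lambda)(z)\,\delta_z$ with $\Xi(T_\alpha,\Lambda)(z)=\int_0^1 f(T_\alpha^{-z}x)f(x)\,dx$, and $$\widehat{\gamma_{\mu_y}}=\sum_{m\in\mathbb{Z}}\big|\widehat{f_\iota}(m)\big|^2\,\delta_{e^{2\pi i\alpha m}},\qquad \widehat{f_\iota}(m)=\int_0^1 f(t)\,e^{-2\pi i m t}\,dt .$$ If moreover $f$ is Riemann integrable, these statements hold for every $y\in[0,1)$.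
   Context: $T_\alpha(x)=\{x+\alpha\}$ on $[0,1)$, with $\{t\}$ the fractional part; $\Lambda$ is Lebesgue measure on $[0,1)$. $\iota(x)=e^{2\pi i x}$ and $f_\iota=f\circ\iota^{-1}$ on $\mathbb{T}$. For a measure $\mu$ on $\mathbb{Z}$, $\widetilde{\mu}(A)=\overline{\mu(-A)}$, $\mu|_n$ is the restriction to $\{|x|\le n\}$, and the autocorrelation $\gamma_\mu$ is the vague limit (pointwise convergence of masses at each $z\in\mathbb{Z}$) of $\frac1{2n+1}\mu|_n*\widetilde{\mu|_n}$. $\mathbb{T}$ is the unit circle with normalised Haar measure $\omega_{\mathbb{T}}$, paired with $\mathbb{Z}$ by $(x,z)=x^z$. The diffraction $\widehat{\gamma}$ of a positive definite translation bounded measure $\gamma$ on $\mathbb{Z}$ is the unique measure on $\mathbb{T}$ with $\int\widehat{\varphi}\,d\gamma=\int\varphi\,d\widehat{\gamma}$ for all $\varphi=l*\widetilde{l}$, $l\in C(\mathbb{T})$, where $\widehat{\varphi}(z)=\int_{\mathbb{T}}\varphi(x)\overline{x^z}\,d\omega_{\mathbb{T}}(x)$ and $\widetilde{l}(x)=\overline{l(x^{-1})}$. *)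

(* Defs.v *)
From mathcomp Require Import all_boot all_order all_algebra all_classical all_reals all_analysis.
From mathcomp Require Import complex.
Set Implicit Arguments.
Unset Strict Implicit.
Unset Printing Implicit Defensive.
Import Order.TTheory GRing.Theory Num.Theory numFieldNormedType.Exports.
Local Open Scope ring_scope.
Local Open Scope classical_set_scope.

Section Defs.
Variable RR : realType.
Local Notation CC := (complex RR).

Definition leb := @completed_lebesgue_measure RR.
Definition lebesgue_measurable_fun (D : set RR) (f : RR -> RR) : Prop :=
  measurable_fun (T := caratheodory_type (R := RR) (wlength (@idfun RR))^*%mu) (U := RR) D f.
Definition unit_ico : set RR := `[0%R, 1%R[.
Definition Rint01 (g : RR -> RR) : RR := Rintegral leb unit_ico g.
Definition cint01 (g : RR -> CC) : CC :=
  Complex (Rint01 (fun t => complex.Re (g t))) (Rint01 (fun t => complex.Im (g t))).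

Definition frac (x : RR) : RR := x - (Num.floor x)%:~R.
Definition Tpow (alpha : RR) (z : int) (y : RR) : RR := frac (y + z%:~R * alpha).

Definition cexp2pi (t : RR) : CC := Complex (cos (2 * pi * t)) (sin (2 * pi * t)).

Definition cabs2 (c : CC) : RR := complex.Re c ^+ 2 + complex.Im c ^+ 2.
Definition cabs (c : CC) : RR := Num.sqrt (cabs2 c).

(* ---------- measures on Z, given by their (real) masses w : int -> RR ---------- *)
Definition restr (w : int -> RR) (n : nat) (a : int) : RR :=
  if `|a| <= n%:Z then w a else 0.
(* mass at z of (1/(2n+1)) mu|_n * ~(mu|_n); for real masses conj is trivial:
   (mu|_n * ~mu|_n)({z}) = sum_a mu|_n(a) mu|_n(a - z) *)
Definition autoc_approx (w : int -> RR) (n : nat) (z : int) : RR :=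
  ((2 * n + 1)%:R)^-1 *
  \sum_(i < (2 * n + 1)%N) restr w n (i%:Z - n%:Z) * restr w n (i%:Z - n%:Z - z).
(* the autocorrelation of w exists and equals gamma (vague = pointwise limit on Z) *)
Definition has_autocorrelation (w : int -> RR) (gamma : int -> RR) : Prop :=
  forall z : int, (fun n : nat => autoc_approx w n z) @ \oo --> gamma z.

Definition zpartial (g : int -> CC) (N : nat) : CC :=
  \sum_(i < (2 * N + 1)%N) g (i%:Z - N%:Z).
Definition zsum_is (g : int -> CC) (s : CC) : Prop :=
  (exists B : RR, forall N : nat, \sum_(i < (2 * N + 1)%N) cabs (g (i%:Z - N%:Z)) <= B)
  /\ (fun N : nat => complex.Re (zpartial g N)) @ \oo --> complex.Re s
  /\ (fun N : nat => complex.Im (zpartial g N)) @ \oo --> complex.Im s.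

Definition translation_bounded (gamma : int -> RR) : Prop :=
  exists B : RR, forall z : int, `|gamma z| <= B.
(* gamma(g * ~g) >= 0 for every finitely supported g on Z *)
Definition positive_definite (gamma : int -> RR) : Prop :=
  forall (k : nat) (c : 'I_k -> CC) (zs : 'I_k -> int),
    let S := \sum_(i < k) \sum_(j < k) c i * conjc (c j) * Complex (gamma (zs i - zs j)) 0 in
    0 <= complex.Re S /\ complex.Im S = 0.

(* ---------- functions on the circle T, via t |-> iota(t), t in R mod 1 ---------- *)
Definition cont_periodic (h : RR -> RR) : Prop :=
  continuous h /\ forall t : RR, h (t + 1) = h t.
Definition ctilde (l : RR -> CC) (t : RR) : CC := conjc (l (- t)).
Definition tconv (l1 l2 : RR -> CC) (s : RR) : CC := cint01 (fun t => l1 (s - t) * l2 t).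
Definition tfourier (h : RR -> CC) (z : int) : CC :=
  cint01 (fun s => h s * conjc (cexp2pi (z%:~R * s))).

(* nu := sum_m c(m) delta_{iota(p m)} (a finite positive measure on T) is the
   diffraction of gamma: gamma is positive definite and translation bounded, and
   int hat(phi) d gamma = int phi d nu for all phi = l * ~l, l in C(T). *)
Definition is_diffraction (gamma : int -> RR) (c : int -> RR) (p : int -> RR) : Prop :=
  positive_definite gamma /\ translation_bounded gamma /\
  (forall m : int, 0 <= c m) /\
  (exists B : RR, forall N : nat, \sum_(i < (2 * N + 1)%N) c (i%:Z - N%:Z) <= B) /\
  forall lr li : RR -> RR, cont_periodic lr -> cont_periodic li ->
    let l := fun t => Complex (lr t) (li t) in
    let phi := tconv l (ctilde l) in
    exists S : CC,
      zsum_is (fun z => tfourier phi z * Complex (gamma z) 0) S /\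
      zsum_is (fun m => Complex (c m) 0 * phi (p m)) S.

Definition mu_y (f : RR -> RR) (alpha y : RR) (z : int) : RR := f (Tpow alpha z y).
Definition Xi (f : RR -> RR) (alpha : RR) (z : int) : RR :=
  Rint01 (fun x => f (Tpow alpha (- z) x) * f x).
Definition fhat (f : RR -> RR) (m : int) : CC :=
  cint01 (fun t => Complex (f t) 0 * conjc (cexp2pi (m%:~R * t))).

Definition riemann_integrable (f : RR -> RR) (a b : RR) : Prop :=
  exists I : RR, forall eps : RR, 0 < eps -> exists2 delta : RR, 0 < delta &
    forall (k : nat) (x xi : nat -> RR),
      x 0%N = a -> x k = b ->
      (forall i : nat, (i < k)%N ->
         [/\ x i < x i.+1, x i.+1 - x i < delta & x i <= xi i <= x i.+1]) ->
      `| \sum_(i < k) f (xi i) * (x i.+1 - x i) - I | < eps.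

End Defs.

(* Main.v *)
Require Import Defs.
From mathcomp Require Import all_boot all_order all_algebra all_classical all_reals all_analysis.
From mathcomp Require Import complex.
From mathcomp Require Import measurable_realfun zify ring lra.
Import Order.TTheory GRing.Theory Num.Theory numFieldNormedType.Exports.
Local Open Scope ring_scope.
Local Open Scope classical_set_scope.
Set Implicit Arguments.
Unset Strict Implicit.
Unset Printing Implicit Defensive.

(* Functions on the circle are treated as bounded measurable 1-periodic functions on the line,
   so that the rotation becomes a translation, under which the mean over [0, 1[ is invariant.

   Trigonometric polynomials are dense for the mean square. Indeed (1 - u ^ n) ^ (2 ^ n), with u
   a suitable trigonometric polynomial of degree one, tends to the indicator of an arc; and the
   definition of the outer measure reduces Lebesgue measurable sets to countable unions of arcs.

   Averages along a rotation orbit converge everywhere for trigonometric polynomials (geometric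
   sums). Garsia's maximal inequality transfers this to almost every starting point for bounded
   measurable functions; if f is Riemann integrable, trigonometric majorants of the approximation
   error give it at every starting point. Applied to f(x) f(x - z alpha), this is the statement
   on the autocorrelation.

   Density also yields Parseval's formula: the mean of k(t + s) conj(k(t)) is the sum of
   |k^(m)|^2 e^(2 pi i m s). Applied to f it expands Xi, and applied to l it expands l * ~l; the
   diffraction formula is then an exchange of two absolutely convergent summations. *)

(** * Translation invariance of Lebesgue measure *)

Section LebesgueShift.
Variable R : realType.
Implicit Types (c : R) (A : set R) (f h : R -> R).

(** Two obstacles shape the proof. The diffraction formula evaluates correlations at the multiples
    of alpha, a null set, so their Fourier expansions are needed at every point. Correlations allow
    this: their coefficients |k^(m)|^2 are nonnegative and summable, so they expand absolutely and
    uniformly even when k is only bounded and measurable. Written out, both sides of the formula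
    become the double sum of b(n) c(m) e^(2 pi i n m alpha), symmetric in the two indices; all
    summability comes from b and c, since the correlations need not decay along the multiples of
    alpha.

    Likewise a single orbit is a null set, so approximation in the mean says nothing about averages
    at a given y. The maximal inequality repairs this outside a set of small measure; a majorant
    that is itself a trigonometric polynomial repairs it at every y. Hence the two notions
    [trig_approx2] and [trig_dom], which start from the same approximants of arcs.

    The two-sided window is treated as two one-sided orbits, of angles alpha and -alpha. *)

Lemma wlength_ocitv_shift c A : ocitv A ->
  ocitv [set x | A (x + c)] /\
  wlength idfun ([set x | A (x + c)] : set (ocitv_type R)) = wlength idfun (A : set (ocitv_type R)).
Proof.
case=> -[a b] _ <- /=.
have -> : [set x | `]a, b]%classic (x + c)] = `]a - c, b - c]%classic.
  by apply/seteqP; split=> x /=; rewrite !in_itv/= ltrBlDr lerBrDr.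
split; first exact: is_ocitv.
rewrite !wlength_itv/= !lte_fin ltrD2r; case: ifP => // _.
by rewrite -!EFinB; congr EFin; rewrite opprD opprK addrACA addNr addr0.
Qed.

(** A cover by half-open intervals translates to a cover of the same total length; the reverse
    inequality is the translation by [- c]. Since [leb] is an outer measure, [A] may be arbitrary,
    and the test sets of the Carathéodory criterion in [lmeas_shift] need this generality. *)
Lemma leb_shift c A : @leb R [set x | A (x + c)] = leb A.
Proof.
have H : forall (d : R) (B : set R), (leb [set x : R | B (x + d)%R] <= @leb R B)%E.
  move=> d B; apply: le_ereal_inf_tmp => _ [F [mF BF] <-].
  apply: ereal_inf_lbound; exists (fun k => [set x | F k (x + d)]).
    split; first by move=> k; have [] := wlength_ocitv_shift d (mF k).
    by move=> x /= /BF[k _ Fk]; exists k.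
  by apply: eq_eseriesr => k _; have [] := wlength_ocitv_shift d (mF k).
apply/eqP; rewrite eq_le H /=.
have {1}-> : A = [set x | [set x | A (x + c)] (x - c)].
  by apply/seteqP; split=> x /=; rewrite subrK.
exact: H.
Qed.

Local Notation LT := (caratheodory_type (R := R) (wlength (@idfun R))^*%mu).

Definition lmeas A : Prop := caratheodory_measurable (R := R) (wlength (@idfun R))^*%mu A.

Lemma lmeas_shift c A : lmeas A -> lmeas [set x | A (x + c)].
Proof.
move=> mA X.
have E B : ((wlength idfun)^*)%mu [set x | B (x + c)] = ((wlength idfun)^*)%mu B.
  exact: leb_shift.
pose Y := [set x | X (x - c)].
have XY : X = [set x | Y (x + c)].
  by apply/seteqP; split=> x; rewrite /Y /= addrK.
have Y1 : [set x | (Y `&` A) (x + c)] = X `&` [set x | A (x + c)].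
  by rewrite [in RHS]XY.
have Y2 : [set x | (Y `&` ~` A) (x + c)] = X `&` ~` [set x | A (x + c)].
  by rewrite [in RHS]XY.
by have := mA Y; rewrite -(E Y) -(E (Y `&` A)) -(E (Y `&` ~` A)) -XY Y1 Y2.
Qed.

Lemma lmeas_ocitv a b : lmeas `]a, b]%classic.
Proof. exact: (@caratheodory_measurable_mu_ext _ R (ocitv_type R) (@wlength R idfun) _ (is_ocitv a b)). Qed.

Lemma lmeas_borel A : @measurable _ (measurableTypeR R) A -> lmeas A.
Proof. by move=> mA; exact: (@sub_caratheodory _ (ocitv_type R) R (@wlength R idfun) _ mA). Qed.

Lemma leb_borel A : @leb R A = lebesgue_measure A.
Proof. by []. Qed.
End LebesgueShift.

(** * Bounded measurable periodic functions and their mean *)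

Section BoundedPeriodic.
Variable R : realType.
Implicit Types (c M : R) (A : set R) (f g h : R -> R).
Local Notation mu := (@leb R).
Local Notation LT := (caratheodory_type (R := R) (wlength (@idfun R))^*%mu).
Local Notation lmf := (@lebesgue_measurable_fun R setT).
Local Notation I01 := (@Rint01 R).
Local Notation U := (@unit_ico R).

(** A working class closed under sums, products, translations and bounded limits: boundedness gives
    integrability on [unit_ico], periodicity gives invariance of the mean. *)
Definition bmp h : Prop :=
  [/\ lmf h, exists M, forall x, `|h x| <= M & forall x, h (x + 1) = h x].

Lemma lmeas_unit : lmeas U.
Proof. by apply: lmeas_borel; exact: measurable_itv. Qed.

Lemma munit : measurable (U : set LT).
Proof. exact: lmeas_unit. Qed.

Lemma leb_unit : mu U = 1%E.
Proof. by rewrite leb_borel lebesgue_measure_itv/= lte_fin ltr01 oppr0 adde0. Qed.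

Lemma lmf_shift c f : lmf f -> lmf (fun x => f (x + c)).
Proof.
move=> mf _ B mB; rewrite setTI.
have := mf measurableT B mB; rewrite setTI => /(lmeas_shift c); exact.
Qed.

Lemma lmf_cont f : continuous f -> lmf f.
Proof.
move=> cf _ B mB; apply: lmeas_borel.
exact: (measurable_realfun.continuous_measurable_fun cf).
Qed.

Lemma bmp_cst c : bmp (fun=> c).
Proof. by split=> //; [exact: measurable_cst|exists `|c|]. Qed.

Lemma bmpD f g : bmp f -> bmp g -> bmp (fun x => f x + g x).
Proof.
move=> [mf [M fM] pf] [mg [N gN] pg]; split.
- exact: measurable_funD.
- by exists (M + N) => x; rewrite (le_trans (ler_normD _ _))// lerD.
- by move=> x; rewrite pf pg.
Qed.

Lemma bmpM f g : bmp f -> bmp g -> bmp (fun x => f x * g x).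
Proof.
move=> [mf [M fM] pf] [mg [N gN] pg]; split.
- exact: measurable_funM.
- by exists (M * N) => x; rewrite normrM ler_pM.
- by move=> x; rewrite pf pg.
Qed.

Lemma bmpN f : bmp f -> bmp (fun x => - f x).
Proof.
move=> bf; have -> : (fun x => - f x) = (fun x => (-1) * f x).
  by apply/funext => x; rewrite mulN1r.
by apply: bmpM => //; exact: bmp_cst.
Qed.

Lemma bmpB f g : bmp f -> bmp g -> bmp (fun x => f x - g x).
Proof. by move=> bf bg; apply: bmpD => //; exact: bmpN. Qed.

Lemma bmpX f n : bmp f -> bmp (fun x => f x ^+ n).
Proof.
move=> bf; elim: n => [|n IH]; first exact: bmp_cst.
by under eq_fun do rewrite exprS; exact: bmpM.
Qed.

Lemma bmp_sum (I : Type) (r : seq I) (P : pred I) (F : I -> R -> R) :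
  (forall i, bmp (F i)) -> bmp (fun x => \sum_(i <- r | P i) F i x).
Proof.
move=> bF; elim: r => [|i r IH].
  by under eq_fun do rewrite big_nil; exact: bmp_cst.
under eq_fun do rewrite big_cons.
by case: (P i) => //; exact: bmpD.
Qed.

Lemma bmp_norm f : bmp f -> bmp (fun x => `|f x|).
Proof.
move=> [mf [M fM] pf]; split; first exact: measurableT_comp.
- by exists M => x; rewrite normr_id.
- by move=> x; rewrite pf.
Qed.

Lemma bmp_max f g : bmp f -> bmp g -> bmp (fun x => Num.max (f x) (g x)).
Proof.
move=> [mf [M fM] pf] [mg [N gN] pg]; split.
- exact: measurable_maxr.
- exists (M + N) => x; have := fM x; have := gN x; rewrite maxEle.
  have := normr_ge0 (f x); have := normr_ge0 (g x); case: ifP; lra.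
- by move=> x; rewrite pf pg.
Qed.

Lemma bmp_shift c f : bmp f -> bmp (fun x => f (x + c)).
Proof.
move=> [mf [M fM] pf]; split; first exact: lmf_shift.
- by exists M.
- by move=> x; rewrite addrAC pf.
Qed.

Lemma bmp_lim (h_ : nat -> R -> R) h M : (forall n, bmp (h_ n)) ->
  (forall n x, `|h_ n x| <= M) -> (forall x, h_ ^~ x @ \oo --> h x) -> bmp h.
Proof.
move=> bh hM hh; split.
- apply: (@measurable_fun_cvg _ LT R setT h_ h) => [n|x _]; last exact: hh.
  by have [] := bh n.
- exists M => x; have /cvg_norm hn := hh x.
  by apply: (ler_cvg_to hn (cvg_cst M)); near=> n; exact: hM.
- move=> x; apply: (cvg_unique _ (hh (x + 1))) => //.
  rewrite (_ : h_ ^~ (x + 1) = h_ ^~ x); first exact: hh.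
  by apply/funext => n; have [_ _ ->] := bh n.
Unshelve. all: by end_near. Qed.

Lemma bmp_int f : bmp f -> mu.-integrable (U : set LT) (EFin \o f).
Proof.
move=> [mf [M fM] _]; apply: measurable_bounded_integrable.
- exact: munit.
- exact: (eq_ind_r (fun z => (z < +oo)%E) (ltry 1) leb_unit).
- by apply: measurable_funS mf.
- by exists M; split; [exact: num_real|move=> N MN x _ /=; exact: le_trans (fM x) (ltW MN)].
Qed.

Lemma I01D f g : bmp f -> bmp g -> I01 (fun x => f x + g x) = I01 f + I01 g.
Proof. by move=> bf bg; rewrite /Rint01 RintegralD//; [exact: munit|exact: bmp_int..]. Qed.

Lemma I01B f g : bmp f -> bmp g -> I01 (fun x => f x - g x) = I01 f - I01 g.
Proof. by move=> bf bg; rewrite /Rint01 RintegralB//; [exact: munit|exact: bmp_int..]. Qed.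

Lemma I01Z c f : bmp f -> I01 (fun x => c * f x) = c * I01 f.
Proof. by move=> bf; rewrite /Rint01 RintegralZl//; [exact: munit|exact: bmp_int]. Qed.

Lemma I01_cst c : I01 (fun=> c) = c.
Proof.
rewrite /Rint01 (@Rintegral_cst _ LT R mu U munit).
by rewrite [X in fine X](_ : _ = 1%E) ?mulr1//; exact: leb_unit.
Qed.

Lemma eq_I01 f g : (forall x, U x -> f x = g x) -> I01 f = I01 g.
Proof.
by move=> fg; apply: (@eq_Rintegral _ LT R mu) => x; rewrite inE => /fg.
Qed.

Lemma le_I01 f g : bmp f -> bmp g -> (forall x, U x -> f x <= g x) -> I01 f <= I01 g.
Proof. by move=> bf bg fg; apply: le_Rintegral => //; [exact: munit|exact: bmp_int..]. Qed.

Lemma I01_ge0 f : (forall x, U x -> 0 <= f x) -> 0 <= I01 f.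
Proof. exact: (@Rintegral_ge0 _ LT R mu). Qed.

Lemma I01_norm f : bmp f -> `|I01 f| <= I01 (fun x => `|f x|).
Proof. by move=> bf; apply: le_normr_Rintegral; [exact: munit|exact: bmp_int]. Qed.

Lemma I01_sum (I : Type) (r : seq I) (P : pred I) (F : I -> R -> R) :
  (forall i, bmp (F i)) ->
  I01 (fun x => \sum_(i <- r | P i) F i x) = \sum_(i <- r | P i) I01 (F i).
Proof.
move=> bF; elim: r => [|i r IH].
  by under eq_fun do rewrite big_nil; rewrite big_nil I01_cst.
under eq_fun do rewrite big_cons; rewrite big_cons.
by case: (P i) => //; rewrite I01D// ?IH//; exact: bmp_sum.
Qed.

Lemma I01_bound f c : bmp f -> (forall x, U x -> `|f x| <= c) -> `|I01 f| <= c.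
Proof.
move=> bf fc; rewrite (le_trans (I01_norm bf))// -[leRHS]I01_cst.
by apply: le_I01 => //; [exact: bmp_norm|exact: bmp_cst].
Qed.

Lemma I01_cvg (h_ : nat -> R -> R) h M : (forall n, bmp (h_ n)) -> bmp h ->
  (forall n x, `|h_ n x| <= M) ->
  {ae mu, forall x, U x -> h_ ^~ x @ \oo --> h x} ->
  (fun n => I01 (h_ n)) @ \oo --> I01 h.
Proof.
move=> bh_ bh hM hh.
have h1 : {ae mu, forall x, U x -> (fun n => (EFin \o h_ n) x) @ \oo --> (EFin \o h) x}.
  case: hh => N [mN N0 sN]; exists N; split; [exact: mN|exact: N0|move=> x /= nx; apply: sN => /= hx].
  by apply: nx => /hx hx'; apply/fine_cvgP; split; [exact: nearW|exact: hx'].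
have h2 : {ae mu, forall x n, U x -> (`|(EFin \o h_ n) x| <= (fun=> M%:E) x)%E}.
  by apply: aeW => x n Ux; rewrite lee_fin.
have [_ _] := dominated_convergence munit
  (fun n => measurable_int mu (bmp_int (bh_ n))) (measurable_int mu (bmp_int bh)) h1
  (bmp_int (bmp_cst M)) h2.
move=> H; apply: fine_cvg.
rewrite fineK; first exact: H.
by apply: integrable_fin_num; [exact: munit|exact: bmp_int].
Qed.

Lemma leb_set1 (a : R) : mu [set a] = 0%E.
Proof. by rewrite leb_borel lebesgue_measure_set1. Qed.

Lemma ae_neq (a : R) : {ae mu, forall x, x <> a}.
Proof.
exists ([set a] : set LT); split; last by move=> x /= /contrapT.
- apply: lmeas_borel; exact: measurable_set1.
- exact: leb_set1.
Qed.

Lemma I01_set A : lmeas A -> A `<=` U ->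
  I01 (fun x => \1_A x) = fine (mu A).
Proof.
move=> mA AU; rewrite /Rint01 /Rintegral (integral_indic mu munit mA).
by rewrite (setIidl AU).
Qed.

Definition iint (A : set R) f := Rintegral (mu : {measure set LT -> \bar R}) A f.

Lemma bmp_intS A f : lmeas A -> (exists n : nat, A `<=` `[- n%:R, n%:R]%classic) -> bmp f ->
  mu.-integrable (A : set LT) (EFin \o f).
Proof.
move=> mA [n AN] [mf [M fM] _]; apply: measurable_bounded_integrable; first exact: mA.
- apply: (@le_lt_trans _ _ (mu `[- n%:R, n%:R]%classic)).
    exact: le_outer_measure.
  by rewrite leb_borel lebesgue_measure_itv/=; case: ifP => // _; rewrite -EFinB ltry.
- by apply: measurable_funS mf.
- by exists M; split; [exact: num_real|move=> N MN x _ /=; exact: le_trans (fM x) (ltW MN)].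
Qed.
End BoundedPeriodic.

(** * Invariance of the mean under translation *)

Section MeanShift.
Variable R : realType.
Implicit Types (c M : R) (A : set R) (f g h : R -> R).
Local Notation mu := (@leb R).
Local Notation LT := (caratheodory_type (R := R) (wlength (@idfun R))^*%mu).
Local Notation lmf := (@lebesgue_measurable_fun R setT).
Local Notation I01 := (@Rint01 R).
Local Notation U := (@unit_ico R).
Local Notation frac := (@Defs.frac R).

Lemma iint_shift c A f : lmeas A -> (exists n : nat, A `<=` `[- n%:R, n%:R]%classic) ->
  bmp f ->
  iint [set x | A (x + c)] (fun x => f (x + c)) = iint A f.
Proof.
move=> mA [n An] bf; have [mf _ _] := bf.
have ms : measurable_fun (setT : set LT) ((fun x : R => x + c) : LT -> LT).
  by move=> _ B mB; rewrite setTI; exact: (lmeas_shift c mB).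
have iA : mu.-integrable (A : set LT) (EFin \o f) by apply: bmp_intS => //; exists n.
rewrite /iint /Rintegral; congr fine.
have mE : measurable_fun [set: LT] (EFin \o f) by apply/measurable_EFinP.
have bs : bmp (fun x => f (x + c)) by exact: bmp_shift.
have mAs : lmeas [set x | A (x + c)] by exact: lmeas_shift.
have iAs : mu.-integrable ([set x | A (x + c)] : set LT) (EFin \o (fun x => f (x + c))).
  apply: bmp_intS => //; exists (n + `|Num.ceil `|c| |%N)%N => x /= Ax.
  have := An _ Ax; rewrite /= !in_itv/= natrD natr_absz ger0_norm ?ceil_ge0 ?(lt_le_trans _ (normr_ge0 _))// => /andP[l1 l2].
  have := ceil_ge `|c|; have := ler_norm c; have := ler_norm (- c); rewrite normrN.
  lra.
(* The left side is an integral against the image of [mu] under the translation, and [leb_shift]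
   says that this image is [mu]. *)
rewrite -[LHS](@integral_pushforward _ _ LT LT R _ ms mu A (EFin \o f) mE iAs mA).
apply: eq_measure_integral => B mB _.
exact: leb_shift.
Qed.

Lemma iintU A B f : lmeas A -> lmeas B -> (exists n : nat, A `|` B `<=` `[- n%:R, n%:R]%classic) ->
  [disjoint A & B] -> bmp f -> iint (A `|` B) f = iint A f + iint B f.
Proof.
move=> mA mB AB dAB bf; apply: Rintegral_setU => //.
by apply: bmp_intS => //; exact: (@measurableU _ LT A B mA mB).
Qed.

Lemma per_int h (z : int) x : (forall x, h (x + 1) = h x) -> h (x + z%:~R) = h x.
Proof.
move=> ph; have H : forall (n : nat) y, h (y + n%:R) = h y.
  by elim=> [|n IH] y; rewrite ?addr0// -addn1 natrD addrA ph IH.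
case: z => n; first exact: H.
by rewrite NegzE mulrNz -(H n.+1) -pmulrn subrK.
Qed.

Lemma frac_ico x : U (frac x).
Proof.
rewrite /unit_ico/= in_itv/= /Defs.frac subr_ge0 floor_le/= ltrBlDr addrC.
by have := floorD1_gt x; rewrite intrD.
Qed.

Lemma per_frac h x : (forall x, h (x + 1) = h x) -> h (frac x) = h x.
Proof. by move=> ph; rewrite /Defs.frac -mulrNz per_int. Qed.

Lemma frac_id x : U x -> frac x = x.
Proof.
rewrite /unit_ico/= in_itv/= => /andP[x0 x1]; rewrite /Defs.frac.
by rewrite (@floor_def _ x 0) ?subr0//= x0 add0r.
Qed.

Lemma frac1 x : frac (x + 1) = frac x.
Proof. by rewrite /Defs.frac floorDrz// floor1 intrD opprD addrACA subrr addr0. Qed.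

(** By periodicity [c] may be taken in [0, 1[. The substitution gives the integral over [c, 1 + c[,
    whose part beyond 1 moves back by one period onto [0, c[. *)
Lemma I01_shift c h : bmp h -> I01 (fun x => h (x + c)) = I01 h.
Proof.
move=> bh; have [_ _ ph] := bh.
have -> : (fun x => h (x + c)) = (fun x => h (x + frac c)).
  apply/funext => x; rewrite -[in LHS](subrK (Num.floor c)%:~R c) addrA.
  by rewrite per_int.
move: (frac c) (frac_ico c) => {}c; rewrite /unit_ico/= in_itv/= => /andP[c0 c1].
have icoE (a b : R) : lmeas `[a, b[%classic.
  by apply: lmeas_borel; exact: measurable_itv.
have icoN (a b : R) : -2 <= a -> b <= 2 -> exists n : nat, `[a, b[%classic `<=` `[- n%:R, n%:R : R]%classic.
  by move=> a2 b2; exists 2%N => x /=; rewrite !in_itv/=; lra.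
have Us : [set x | `[c, 1 + c[%classic (x + c)] = U.
  by apply/seteqP; split=> x; rewrite /unit_ico/= !in_itv/=; lra.
have dis (a b d : R) : [disjoint `[a, b[%classic & `[b, d[%classic].
  rewrite disj_set2E; apply/eqP/seteqP; split=> // x [] /=; rewrite !in_itv/=; lra.
have cup (a b d : R) : a <= b -> b <= d -> `[a, b[%classic `|` `[b, d[%classic = `[a, d[%classic.
  move=> ab bd; apply/seteqP; split=> x /=; rewrite !in_itv/=.
    by case=> /andP[xa xb]; lra.
  by move=> /andP[ax xd]; case: (ltP x b) => xb; [left|right]; rewrite ?ax ?xd.
have -> : I01 (fun x => h (x + c)) = iint `[c, 1 + c[%classic h.
  by rewrite -(iint_shift c) ?Us//; apply: icoN; lra.
have -> : I01 h = iint `[0, 1[%classic h by [].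
rewrite -(cup c 1 (1 + c)) ?(ltW c1) ?lerDl// -(cup 0 c 1) ?(ltW c1)//.
rewrite !iintU//; last 2 first.
- by rewrite cup ?(ltW c1)//; apply: icoN; lra.
- by rewrite cup ?(ltW c1) ?lerDl//; apply: icoN; lra.
rewrite addrC; congr (_ + _).
rewrite -(iint_shift 1)//; last by apply: icoN; lra.
have -> : [set x | `[1, 1 + c[%classic (x + 1)] = `[0, c[%classic.
  by apply/seteqP; split=> x /=; rewrite !in_itv/=; lra.
by congr iint; apply/funext => x.
Qed.

Lemma lmeas_frac A : lmeas A -> A `<=` U -> lmeas [set x | A (frac x)].
Proof.
move=> mA AU.
(* [unpickle] enumerates the integers, so the periodisation of [A] is a countable union of its
   translates. *)
have -> : [set x | A (frac x)] = \bigcup_(k in [set: nat])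
    (if unpickle k is Some n then [set x | A (x - (n : int)%:~R)] else set0).
  apply/seteqP; split=> x /=.
    by move=> Ax; exists (pickle (Num.floor x)); [|rewrite pickleK].
  move=> [k _]; case: unpickle => // n /= An.
  have := per_int (- n) x frac1; rewrite mulrNz => <-.
  by rewrite frac_id//; exact: AU.
apply: (@bigcupT_measurable _ LT) => k; case: unpickle => [n|].
  by apply: (@lmeas_shift R _ _ mA).
exact: (@measurable0 _ LT).
Qed.

Lemma bmp_frac f M : @lebesgue_measurable_fun R U f -> (forall x, U x -> `|f x| <= M) ->
  bmp (fun x => f (frac x)).
Proof.
move=> mf fM; split.
- move=> _ B mB; rewrite setTI.
  rewrite (_ : _ @^-1` _ = [set x | (U `&` f @^-1` B) (frac x)]); last first.
    apply/seteqP; split=> x /=; first by move=> Bx; split => //; exact: frac_ico.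
    by case.
  apply: lmeas_frac; last exact: subIsetl.
  exact: (mf (@munit R) B mB).
- by exists M => x; apply: fM; exact: frac_ico.
- by move=> x; rewrite frac1.
Qed.

Lemma bmp_ind A : lmeas A -> A `<=` U -> bmp (fun x => \1_A (frac x)).
Proof.
move=> mA AU; apply: (@bmp_frac (\1_A) 1).
  by apply: (@measurable_funTS _ _ LT R); exact: (@measurable_indic _ LT R setT A mA).
by move=> x _; rewrite indicE; case: (_ \in _); rewrite ?normr1 ?normr0.
Qed.

Lemma I01_frac f : I01 (fun x => f (frac x)) = I01 f.
Proof. by apply: eq_I01 => x Ux; rewrite frac_id. Qed.

End MeanShift.

(** * Exponentials and trigonometric polynomials *)

Section Exponentials.
Variable R : realType.
Local Notation CC := (complex R).
Local Notation I01 := (@Rint01 R).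
Local Notation U := (@unit_ico R).
Local Notation frac := (@Defs.frac R).
Local Notation e := (@cexp2pi R).
Local Notation Re := (@complex.Re R).
Local Notation Im := (@complex.Im R).
Implicit Types (s t x : R) (z w : CC) (m : int) (k l p q : R -> CC).

Definition echar m x : CC := e (m%:~R * x).

Lemma complexP z w : Re z = Re w -> Im z = Im w -> z = w.
Proof. by case: z w => [a b] [c d] /= -> ->. Qed.

Lemma cReD z w : Re (z + w) = Re z + Re w. Proof. by case: z w => [a b] [c d]. Qed.
Lemma cImD z w : Im (z + w) = Im z + Im w. Proof. by case: z w => [a b] [c d]. Qed.
Lemma cReN z : Re (- z) = - Re z. Proof. by case: z. Qed.
Lemma cImN z : Im (- z) = - Im z. Proof. by case: z. Qed.
Lemma cReM z w : Re (z * w) = Re z * Re w - Im z * Im w.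
Proof. by case: z w => [a b] [c d]. Qed.
Lemma cImM z w : Im (z * w) = Re z * Im w + Im z * Re w.
Proof. by case: z w => [a b] [c d] /=. Qed.
Lemma cReJ z : Re (conjc z) = Re z. Proof. by case: z. Qed.
Lemma cImJ z : Im (conjc z) = - Im z. Proof. by case: z. Qed.
Lemma cRe_sum (I : Type) (r : seq I) (P : pred I) (F : I -> CC) :
  Re (\sum_(i <- r | P i) F i) = \sum_(i <- r | P i) Re (F i).
Proof. by elim/big_rec2: _ => // i x y _ <-; rewrite cReD. Qed.
Lemma cIm_sum (I : Type) (r : seq I) (P : pred I) (F : I -> CC) :
  Im (\sum_(i <- r | P i) F i) = \sum_(i <- r | P i) Im (F i).
Proof. by elim/big_rec2: _ => // i x y _ <-; rewrite cImD. Qed.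
Definition ReImE := (cReD, cImD, cReN, cImN, cReM, cImM, cReJ, cImJ).

Lemma cexpD s t : e (s + t) = e s * e t.
Proof. by apply: complexP; rewrite ReImE /= mulrDr ?cosD ?sinD//; ring. Qed.

Lemma cexpN t : e (- t) = conjc (e t).
Proof. by apply: complexP; rewrite ReImE /= mulrN ?cosN ?sinN. Qed.

Lemma cexp0 : e 0 = 1.
Proof. by apply: complexP; rewrite /= mulr0 ?cos0 ?sin0. Qed.

Lemma cexp1 : e 1 = 1.
Proof.
by apply: complexP; rewrite /= mulr1 mulr_natl ?cos2pi// -[pi *+ 2]add0r sinD2pi sin0.
Qed.

Lemma cexp_int m : e m%:~R = 1.
Proof.
have H (n : nat) : e n%:R = 1.
  by elim: n => [|n IH]; rewrite ?cexp0// -addn1 natrD cexpD IH cexp1 mulr1.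
case: m => n; first exact: H.
by rewrite NegzE mulrNz cexpN -pmulrn H; apply: complexP; rewrite ReImE /= ?oppr0.
Qed.

Lemma echar_per m x : echar m (x + 1) = echar m x.
Proof. by rewrite /echar mulrDr mulr1 cexpD cexp_int mulr1. Qed.

Lemma echar_add m s t : echar m (s + t) = echar m s * echar m t.
Proof. by rewrite /echar mulrDr cexpD. Qed.

Lemma echar_mul m n x : echar m x * echar n x = echar (m + n) x.
Proof. by rewrite /echar intrD mulrDl cexpD. Qed.

Lemma echar_conj m x : conjc (echar m x) = echar (- m) x.
Proof. by rewrite /echar mulrNz mulNr cexpN. Qed.

Lemma echar0 x : echar 0 x = 1.
Proof. by rewrite /echar mul0r cexp0. Qed.

Lemma cabs2_ge0 z : 0 <= cabs2 z.
Proof. by rewrite addr_ge0 ?sqr_ge0. Qed.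

Lemma cabs2_conj z : Complex (cabs2 z) 0 = z * conjc z.
Proof. by apply: complexP; rewrite !ReImE /= /cabs2; ring. Qed.

(** The real part suffices: cos (2 pi s) = 1 - 2 sin (pi s)^2, and sin (pi s) > 0 for 0 < s < 1,
    where s is the fractional part of [t]. *)
Lemma cexp_eq1 t : e t = 1 -> exists n : int, t = n%:~R.
Proof.
move=> et; exists (Num.floor t).
have ef : e (frac t) = 1.
  by rewrite /Defs.frac cexpD -mulrNz cexp_int et mulr1.
have := frac_ico t; rewrite /unit_ico/= in_itv/= => /andP[f0 f1].
move: f0; rewrite le_eqVlt => /predU1P[f0|f0].
  by apply/eqP; rewrite -subr_eq0; apply/eqP; rewrite [RHS]f0.
have := congr1 Re ef; rewrite /= => c1.
have sp : 0 < sin (pi * frac t).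
  by apply: sin_gt0_pi; rewrite mulr_gt0 ?pi_gt0//= -[ltRHS]mulr1 ltr_pM2l ?pi_gt0.
have : cos (2 * pi * frac t) = 1 - 2 * sin (pi * frac t) ^+ 2.
  rewrite -mulrA mulr_natl mulr2n cosD; have := cos2Dsin2 (pi * frac t).
  by rewrite !expr2; lra.
rewrite c1 => h; have := mulr_gt0 sp sp; move: h; rewrite expr2; lra.
Qed.

(** This is where irrationality enters: m alpha = n would give alpha = n / m. *)
Lemma irrational_echar (alpha : R) m : (forall q : rat, alpha != ratr q) -> m != 0 -> echar m alpha <> 1.
Proof.
move=> irr m0 /cexp_eq1[n mn].
have := irr (n%:~R / m%:~R); rewrite fmorph_div /= !rmorph_int -mn mulrAC divff ?mul1r ?eqxx//.
by rewrite intr_eq0.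
Qed.

Definition cbmp k := bmp (Re \o k) /\ bmp (Im \o k).

Lemma cbmpD k l : cbmp k -> cbmp l -> cbmp (fun x => k x + l x).
Proof.
move=> [rk ik] [rl il]; split.
- by rewrite (_ : _ \o _ = fun x => (Re \o k) x + (Re \o l) x); [exact: bmpD|apply/funext => x; rewrite /= cReD].
- by rewrite (_ : _ \o _ = fun x => (Im \o k) x + (Im \o l) x); [exact: bmpD|apply/funext => x; rewrite /= cImD].
Qed.

Lemma cbmpM k l : cbmp k -> cbmp l -> cbmp (fun x => k x * l x).
Proof.
move=> [rk ik] [rl il]; split.
- rewrite (_ : _ \o _ = fun x => (Re \o k) x * (Re \o l) x - (Im \o k) x * (Im \o l) x).
    by apply: bmpB; exact: bmpM.
  by apply/funext => x; rewrite /= cReM.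
- rewrite (_ : _ \o _ = fun x => (Re \o k) x * (Im \o l) x + (Im \o k) x * (Re \o l) x).
    by apply: bmpD; exact: bmpM.
  by apply/funext => x; rewrite /= cImM.
Qed.

Lemma cbmpJ k : cbmp k -> cbmp (fun x => conjc (k x)).
Proof.
move=> [rk ik]; split.
- by rewrite (_ : _ \o _ = Re \o k)//; apply/funext => x; rewrite /= cReJ.
- by rewrite (_ : _ \o _ = (fun x => - (Im \o k) x)); [exact: bmpN|apply/funext => x; rewrite /= cImJ].
Qed.

Lemma cbmp_cst z : cbmp (fun=> z).
Proof. by split; exact: bmp_cst. Qed.

Lemma cbmpZ z k : cbmp k -> cbmp (fun x => z * k x).
Proof. by move=> bk; apply: cbmpM => //; exact: cbmp_cst. Qed.

Lemma cbmpN k : cbmp k -> cbmp (fun x => - k x).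
Proof. by move=> bk; under eq_fun do rewrite -mulN1r; exact: cbmpZ. Qed.

Lemma cbmpB k l : cbmp k -> cbmp l -> cbmp (fun x => k x - l x).
Proof. by move=> bk bl; apply: cbmpD => //; exact: cbmpN. Qed.

Lemma cbmp_shift (c : R) k : cbmp k -> cbmp (fun x => k (x + c)).
Proof. by move=> [rk ik]; split; [exact: (bmp_shift c rk)|exact: (bmp_shift c ik)]. Qed.

Lemma cbmp_sum (I : Type) (r : seq I) (P : pred I) (F : I -> R -> CC) :
  (forall i, cbmp (F i)) -> cbmp (fun x => \sum_(i <- r | P i) F i x).
Proof.
move=> bF; elim: r => [|i r IH].
  by under eq_fun do rewrite big_nil; exact: cbmp_cst.
under eq_fun do rewrite big_cons.
by case: (P i) => //; exact: cbmpD.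
Qed.

Lemma cbmp_real (h : R -> R) : bmp h -> cbmp (fun x => Complex (h x) 0).
Proof. by split => //; exact: bmp_cst. Qed.

Lemma bmp_cabs2 k : cbmp k -> bmp (fun x => cabs2 (k x)).
Proof. by move=> [rk ik]; apply: bmpD; exact: (bmpX 2). Qed.

Lemma bmp_per_cont (h : R -> R) : cont_periodic h -> bmp h.
Proof.
move=> [ch ph]; split => //; first exact: lmf_cont.
have c01 : {within `[0 : R, 1], continuous h} by apply: continuous_subspaceT.
have [a _ ha] := EVT_max (@ler01 R) c01.
have [b _ hb] := EVT_min (@ler01 R) c01.
exists (`|h a| + `|h b|) => x.
have := frac_ico x; rewrite /unit_ico/= in_itv/= => /andP[f0 f1].
have fx : (frac x \in `[(0 : R), 1])%R by rewrite in_itv/= f0 ltW.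
rewrite -(per_frac x ph); have := ha _ fx; have := hb _ fx.
have := ler_norm (h a); have := ler_norm (- h b); rewrite normrN => *.
have := normr_ge0 (h a); have := normr_ge0 (h b) => *.
by rewrite ler_norml; apply/andP; split; lra.
Qed.

Lemma cbmp_echar m : cbmp (echar m).
Proof.
have cm : continuous (fun x : R => 2 * pi * (m%:~R * x)).
  by move=> x; do 2 (apply: cvgM; first exact: cvg_cst); exact: cvg_id.
split; apply: bmp_per_cont; split.
- by move=> x; apply: continuous_comp; [exact: cm|exact: continuous_cos].
- by move=> x; exact: (congr1 Re (echar_per m x)).
- by move=> x; apply: continuous_comp; [exact: cm|exact: continuous_sin].
- by move=> x; exact: (congr1 Im (echar_per m x)).
Qed.

Lemma cintD k l : cbmp k -> cbmp l -> cint01 (fun x => k x + l x) = cint01 k + cint01 l.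
Proof.
move=> [rk ik] [rl il]; apply: complexP; rewrite ReImE /= -I01D//; congr Rint01;
  by apply/funext => x; rewrite /= ReImE.
Qed.

Lemma cintB k l : cbmp k -> cbmp l -> cint01 (fun x => k x - l x) = cint01 k - cint01 l.
Proof.
move=> [rk ik] [rl il]; apply: complexP; rewrite !ReImE /= -I01B//; congr Rint01;
  by apply/funext => x; rewrite /= !ReImE.
Qed.

Lemma cintZ z k : cbmp k -> cint01 (fun x => z * k x) = z * cint01 k.
Proof.
move=> [rk ik]; apply: complexP; rewrite !ReImE /= -!I01Z//.
- rewrite -I01B; [|by apply: bmpM => //; exact: bmp_cst..].
  by congr Rint01; apply/funext => x; rewrite /= !ReImE.
- rewrite -I01D; [|by apply: bmpM => //; exact: bmp_cst..].
  by congr Rint01; apply/funext => x; rewrite /= !ReImE.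
Qed.

Lemma cint_sum (I : Type) (r : seq I) (P : pred I) (F : I -> R -> CC) :
  (forall i, cbmp (F i)) ->
  cint01 (fun x => \sum_(i <- r | P i) F i x) = \sum_(i <- r | P i) cint01 (F i).
Proof.
move=> bF; elim: r => [|i r IH].
  under eq_fun do rewrite big_nil; rewrite big_nil.
  by apply: complexP; rewrite /= I01_cst.
under eq_fun do rewrite big_cons; rewrite big_cons.
by case: (P i) => //; rewrite cintD// ?IH//; exact: cbmp_sum.
Qed.

Lemma cint_conj k : cbmp k -> cint01 (fun x => conjc (k x)) = conjc (cint01 k).
Proof.
move=> [rk ik]; apply: complexP; rewrite !ReImE /=.
- by congr Rint01; apply/funext => x; rewrite cReJ.
- rewrite -mulN1r -I01Z//; congr Rint01; apply/funext => x.
  by rewrite cImJ mulN1r.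
Qed.

Lemma cint_shift (c : R) k : cbmp k -> cint01 (fun x => k (x + c)) = cint01 k.
Proof.
by move=> [rk ik]; apply: complexP => /=; [exact: (I01_shift c rk)|exact: (I01_shift c ik)].
Qed.

Lemma cint_cst z : cint01 (fun=> z) = z.
Proof. by apply: complexP; rewrite /= I01_cst. Qed.

Lemma cint_real (h : R -> R) : cint01 (fun x => Complex (h x) 0) = Complex (Rint01 h) 0.
Proof. by apply: complexP; rewrite //= I01_cst. Qed.

(* A translation multiplies [echar m] by a phase, so invariance of the mean kills it. *)
Lemma cint_echar m : cint01 (echar m) = if m == 0 then 1 else 0.
Proof.
case: eqVneq => [->|m0].
  by rewrite (_ : echar 0 = fun=> 1) ?cint_cst//; apply/funext => x; rewrite echar0.
have mR : (m%:~R : R) != 0 by rewrite intr_eq0.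
have e2 : e 2^-1 = -1.
  by apply: complexP; rewrite /= mulrAC divff ?mul1r ?cospi ?sinpi ?oppr0.
(* This shift makes the phase exactly -1, so the mean equals its own negative. *)
have := cint_shift ((2 * m%:~R)^-1) (cbmp_echar m).
under eq_fun do rewrite echar_add mulrC.
rewrite cintZ; last exact: cbmp_echar.
have -> : echar m (2 * m%:~R)^-1 = -1 by rewrite /echar invfM mulrCA divff// mulr1.
rewrite -[cint01 _]/(cint01 (echar m)); move: (cint01 (echar m)) => z; rewrite mulN1r => h.
have := congr1 Re h; have := congr1 Im h; rewrite !ReImE => h1 h2.
by apply: complexP; lra.
Qed.

(** A predicate rather than a list of coefficients: closure properties, Fourier sums and orbit
    averages all follow by induction from the case of one character. *)
Inductive trig : (R -> CC) -> Prop :=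
| trig_mono z m : trig (fun x => z * echar m x)
| trig_add p q : trig p -> trig q -> trig (fun x => p x + q x).

Lemma trig_cst z : trig (fun=> z).
Proof.
by rewrite (_ : (fun=> z) = fun x => z * echar 0 x); [exact: trig_mono|apply/funext => x; rewrite echar0 mulr1].
Qed.

Lemma trigM p q : trig p -> trig q -> trig (fun x => p x * q x).
Proof.
move=> tp tq; elim: tp => [z m|p1 p2 _ IH1 _ IH2]; last first.
  by under eq_fun do rewrite mulrDl; exact: trig_add.
elim: tq => [w n|p1 p2 _ IH1 _ IH2]; last first.
  by under eq_fun do rewrite mulrDr; exact: trig_add.
rewrite (_ : (fun x => _) = fun x => (z * w) * echar (m + n) x); first exact: trig_mono.
by apply/funext => x; rewrite -echar_mul; ring.
Qed.

Lemma trigJ p : trig p -> trig (fun x => conjc (p x)).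
Proof.
elim=> [z m|p1 p2 _ IH1 _ IH2].
  rewrite (_ : (fun x => _) = fun x => conjc z * echar (- m) x); first exact: trig_mono.
  by apply/funext => x; rewrite -echar_conj rmorphM.
rewrite (_ : (fun x => _) = fun x => conjc (p1 x) + conjc (p2 x)); first exact: trig_add.
by apply/funext => x; rewrite rmorphD.
Qed.

Lemma trig_shift (c : R) p : trig p -> trig (fun x => p (x + c)).
Proof.
elim=> [z m|p1 p2 _ IH1 _ IH2]; last exact: trig_add.
rewrite (_ : (fun x => _) = fun x => (z * echar m c) * echar m x); first exact: trig_mono.
by apply/funext => x; rewrite echar_add; ring.
Qed.

Lemma trig_cbmp p : trig p -> cbmp p.
Proof.
elim=> [z m|p1 p2 _ IH1 _ IH2]; last exact: cbmpD.
by apply: cbmpZ; exact: cbmp_echar.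
Qed.

Definition rtrig (p : R -> R) := trig (fun x => Complex (p x) 0).

Lemma rtrig_bmp (p : R -> R) : rtrig p -> bmp p.
Proof. by move=> /trig_cbmp[]. Qed.

Lemma rtrig_cst (c : R) : rtrig (fun=> c).
Proof. exact: trig_cst. Qed.

Lemma rtrigD (p q : R -> R) : rtrig p -> rtrig q -> rtrig (fun x => p x + q x).
Proof.
move=> tp tq; have := trig_add tp tq; rewrite (_ : (fun x => _) = fun x => Complex (p x + q x) 0)//.
by apply/funext => x; apply: complexP; rewrite ReImE /= ?addr0.
Qed.

Lemma rtrigM (p q : R -> R) : rtrig p -> rtrig q -> rtrig (fun x => p x * q x).
Proof.
move=> tp tq; have := trigM tp tq; rewrite (_ : (fun x => _) = fun x => Complex (p x * q x) 0)//.
by apply/funext => x; apply: complexP; rewrite ReImE /= ?mulr0 ?mul0r ?subr0 ?addr0.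
Qed.

Lemma rtrigN (p : R -> R) : rtrig p -> rtrig (fun x => - p x).
Proof. by move=> tp; under eq_fun do rewrite -mulN1r; apply: rtrigM => //; exact: rtrig_cst. Qed.

Lemma rtrigB (p q : R -> R) : rtrig p -> rtrig q -> rtrig (fun x => p x - q x).
Proof. by move=> tp tq; apply: rtrigD => //; exact: rtrigN. Qed.

Lemma rtrigX (p : R -> R) n : rtrig p -> rtrig (fun x => p x ^+ n).
Proof.
move=> tp; elim: n => [|n IH]; first exact: rtrig_cst.
by under eq_fun do rewrite exprS; exact: rtrigM.
Qed.

Lemma rtrig_shift (c : R) (p : R -> R) : rtrig p -> rtrig (fun x => p (x + c)).
Proof. by move=> tp; exact: (trig_shift c tp). Qed.

Lemma rtrig_Re p : trig p -> rtrig (fun x => Re (p x)).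
Proof.
move=> tp; have := trigM (trig_cst (Complex 2^-1 0)) (trig_add tp (trigJ tp)).
rewrite /rtrig (_ : (fun x => _) = fun x => Complex (Re (p x)) 0)//.
by apply/funext => x; apply: complexP; rewrite !ReImE /=; lra.
Qed.

Lemma rtrig_cos (t : R) : rtrig (fun x => cos (2 * pi * x + t)).
Proof.
have := rtrig_Re (trig_mono (Complex (cos t) (sin t)) 1).
rewrite (_ : (fun x => _) = (fun x => cos (2 * pi * x + t)))//.
by apply/funext => x; rewrite cReM /= mul1r cosD; ring.
Qed.

End Exponentials.

(** * Density of trigonometric polynomials *)

Section SquareApproximation.
Variable R : realType.
Local Notation I01 := (@Rint01 R).
Local Notation U := (@unit_ico R).
Local Notation mu := (@leb R).
Local Notation LT := (caratheodory_type (R := R) (wlength (@idfun R))^*%mu).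
Local Notation frac := (@Defs.frac R).
Implicit Types (a b x : R) (f g h p q : R -> R).

(** The error is measured in mean square because the orthogonality argument behind Parseval's
    formula lives there; [trig_approx1] recovers the mean absolute error. *)
Definition trig_approx2 h := bmp h /\
  forall eps : R, 0 < eps -> exists p, rtrig p /\ I01 (fun x => (h x - p x) ^+ 2) < eps.

Lemma trig_approx2_rtrig p : rtrig p -> trig_approx2 p.
Proof.
move=> tp; split; first exact: rtrig_bmp.
move=> eps e0; exists p; split=> //.
by under eq_fun do rewrite subrr expr0n; rewrite I01_cst.
Qed.

(** The inequality (u + v)^2 <= 2 u^2 + 2 v^2 takes the place of the triangle inequality, which
    would need square roots; hence the two errors of [eps / 4]. *)
Lemma trig_approx2_closed h : bmp h ->
  (forall eps : R, 0 < eps -> exists g, trig_approx2 g /\ I01 (fun x => (h x - g x) ^+ 2) < eps) ->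
  trig_approx2 h.
Proof.
move=> bh H; split=> // eps e0.
have e4 : 0 < eps / 4 by rewrite divr_gt0.
have [g [[bg /(_ _ e4)[p [tp gp]]] hg]] := H _ e4.
exists p; split=> //; have bp := rtrig_bmp tp.
have b1 : bmp (fun x => (h x - g x) ^+ 2) by apply: bmpX; exact: bmpB.
have b2 : bmp (fun x => (g x - p x) ^+ 2) by apply: bmpX; exact: bmpB.
apply: (@le_lt_trans _ _ (2 * I01 (fun x => (h x - g x) ^+ 2) + 2 * I01 (fun x => (g x - p x) ^+ 2))).
  have c2 := bmp_cst (2 : R).
  rewrite -!I01Z// -I01D; [|exact: bmpM..].
  apply: le_I01 => [||x _]; [by apply: bmpX; exact: bmpB|by apply: bmpD; exact: bmpM|].
  by have := sqr_ge0 ((h x - g x) - (g x - p x)); rewrite !expr2; lra.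
lra.
Qed.

Lemma trig_approx2D f g : trig_approx2 f -> trig_approx2 g -> trig_approx2 (fun x => f x + g x).
Proof.
move=> [bf af] [bg ag]; split; first exact: bmpD.
move=> eps e0; have e4 : 0 < eps / 4 by rewrite divr_gt0.
have [p [tp fp]] := af _ e4; have [q [tq gq]] := ag _ e4.
have bp := rtrig_bmp tp; have bq := rtrig_bmp tq.
exists (fun x => p x + q x); split; first exact: rtrigD.
have b1 : bmp (fun x => (f x - p x) ^+ 2) by apply: bmpX; exact: bmpB.
have b2 : bmp (fun x => (g x - q x) ^+ 2) by apply: bmpX; exact: bmpB.
apply: (@le_lt_trans _ _ (2 * I01 (fun x => (f x - p x) ^+ 2) + 2 * I01 (fun x => (g x - q x) ^+ 2))).
  have c2 := bmp_cst (2 : R).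
  rewrite -!I01Z// -I01D; [|exact: bmpM..].
  apply: le_I01 => [||x _]; [by apply: bmpX; apply: bmpB; exact: bmpD|by apply: bmpD; exact: bmpM|].
  by have := sqr_ge0 ((f x - p x) - (g x - q x)); rewrite !expr2; lra.
lra.
Qed.

(** From f g - p q = f (g - q) + q (f - p). The order of choice matters: [q] comes first, because
    the precision of [p] depends on the bound [N] of [q]. *)
Lemma trig_approx2M f g : trig_approx2 f -> trig_approx2 g -> trig_approx2 (fun x => f x * g x).
Proof.
move=> [bf af] [bg ag]; split; first exact: bmpM.
move=> eps e0.
have [_ [M fM] _] := bf.
have M0 : 0 <= M by exact: le_trans (fM 0).
have e1 : 0 < eps / (4 * (M ^+ 2 + 1)).
  by rewrite divr_gt0// mulr_gt0// ltr_wpDl ?sqr_ge0.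
have [q [tq gq]] := ag _ e1; have bq := rtrig_bmp tq.
have [_ [N qN] _] := bq.
have N0 : 0 <= N by exact: le_trans (qN 0).
have e2 : 0 < eps / (4 * (N ^+ 2 + 1)).
  by rewrite divr_gt0// mulr_gt0// ltr_wpDl ?sqr_ge0.
have [p [tp fp]] := af _ e2; have bp := rtrig_bmp tp.
exists (fun x => p x * q x); split; first exact: rtrigM.
have b1 : bmp (fun x => (f x - p x) ^+ 2) by apply: bmpX; exact: bmpB.
have b2 : bmp (fun x => (g x - q x) ^+ 2) by apply: bmpX; exact: bmpB.
apply: (@le_lt_trans _ _ (2 * (M ^+ 2 + 1) * I01 (fun x => (g x - q x) ^+ 2) +
                          2 * (N ^+ 2 + 1) * I01 (fun x => (f x - p x) ^+ 2))).
  have c1 := bmp_cst (2 * (M ^+ 2 + 1)); have c2 := bmp_cst (2 * (N ^+ 2 + 1)).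
  rewrite -!I01Z// -I01D; [|exact: bmpM..].
  apply: le_I01 => [||x _]; [by apply: bmpX; apply: bmpB; exact: bmpM|by apply: bmpD; exact: bmpM|].
  have -> : f x * g x - p x * q x = f x * (g x - q x) + q x * (f x - p x) by ring.
  have h1 : (f x) ^+ 2 <= M ^+ 2 + 1.
    by rewrite -[leLHS]real_normK ?num_real// ler_wpDr// lerXn2r ?nnegrE.
  have h2 : (q x) ^+ 2 <= N ^+ 2 + 1.
    by rewrite -[leLHS]real_normK ?num_real// ler_wpDr// lerXn2r ?nnegrE.
  have h3 := ler_wpM2r (sqr_ge0 (g x - q x)) h1.
  have h4 := ler_wpM2r (sqr_ge0 (f x - p x)) h2.
  have := sqr_ge0 (f x * (g x - q x) - q x * (f x - p x)).
  by move: h3 h4; rewrite !expr2; lra.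
have h1 : 2 * (M ^+ 2 + 1) * I01 (fun x => (g x - q x) ^+ 2) < eps / 2.
  rewrite mulrC -ltr_pdivlMr; last by rewrite mulr_gt0// ltr_wpDl ?sqr_ge0.
  by rewrite (lt_le_trans gq)// -mulrA ler_pM2l// -invfM -[4]/(2 * 2)%:R natrM -mulrA.
have h2 : 2 * (N ^+ 2 + 1) * I01 (fun x => (f x - p x) ^+ 2) < eps / 2.
  rewrite mulrC -ltr_pdivlMr; last by rewrite mulr_gt0// ltr_wpDl ?sqr_ge0.
  by rewrite (lt_le_trans fp)// -mulrA ler_pM2l// -invfM -[4]/(2 * 2)%:R natrM -mulrA.
lra.
Qed.

(** Dominated convergence turns bounded almost everywhere convergence into mean-square convergence.
    With sums and products, this closure leads from arcs to all bounded measurable functions. *)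
Lemma trig_approx2_lim (h_ : nat -> R -> R) h M : bmp h ->
  (forall n, trig_approx2 (h_ n)) -> (forall n x, `|h_ n x| <= M) ->
  {ae mu, forall x, U x -> h_ ^~ x @ \oo --> h x} -> trig_approx2 h.
Proof.
move=> bh ah hM hh; apply: trig_approx2_closed => // eps e0.
have [_ [N hN] _] := bh.
have M0 : 0 <= M by exact: le_trans (hM 0%N 0).
have N0 : 0 <= N by exact: le_trans (hN 0).
have : (fun n => I01 (fun x => (h x - h_ n x) ^+ 2)) @ \oo --> I01 (fun=> 0).
  apply: (@I01_cvg _ _ _ ((N + M) ^+ 2)) => [n| |n x|].
  - by apply: bmpX; apply: bmpB => //; have [] := ah n.
  - exact: bmp_cst.
  - rewrite normrX lerXn2r ?nnegrE ?addr_ge0//.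
    by rewrite (le_trans (ler_normB _ _))// lerD.
  - case: hh => Z [mZ Z0 sZ]; exists Z; split; [exact: mZ|exact: Z0|].
    move=> x /= nx; apply: sZ => /= hx; apply: nx => /hx {}hx.
    rewrite (_ : 0 = (h x - h x) ^+ 2); last by rewrite subrr expr0n.
    apply: (@cvg_comp _ _ _ _ (fun y => y ^+ 2) _ (nbhs (h x - h x))).
      by apply: cvgB => //; exact: cvg_cst.
    exact: exprn_continuous.
rewrite I01_cst => /cvgrPdist_lt/(_ _ e0)[n _ /(_ n (leqnn n))].
rewrite sub0r normrN => hn; exists (h_ n); split; first exact: ah.
exact: le_lt_trans (ler_norm _) hn.
Qed.

Lemma trig_approx2_ae h g : bmp h -> trig_approx2 g ->
  {ae mu, forall x, U x -> h x = g x} -> trig_approx2 h.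
Proof.
move=> bh ag hg; have [[_ [M gM] _] _] := ag.
apply: (@trig_approx2_lim (fun=> g) _ M) => //.
case: hg => Z [mZ Z0 sZ]; exists Z; split; [exact: mZ|exact: Z0|].
by move=> x /= nx; apply: sZ => /= hx; apply: nx => /hx ->; exact: cvg_cst.
Qed.

(** The product sin (pi x) sin (pi (x - a)), written as a trigonometric polynomial of degree one:
    negative on ]0, a[, positive on ]a, 1[. *)
Definition vstep a x : R := (cos (pi * a) - cos (2 * pi * x - pi * a)) / 2.

Lemma vstepE a x : vstep a x = sin (pi * x) * sin (pi * (x - a)).
Proof.
rewrite /vstep.
have -> : 2 * pi * x - pi * a = pi * x + pi * (x - a) by ring.
have -> : pi * a = pi * x - pi * (x - a) by ring.
by rewrite cosB cosD; field.
Qed.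

Lemma vstep_le1 a x : `|vstep a x| <= 1.
Proof. by rewrite vstepE normrM mulr_ile1// ?ler_norml ?sin_geN1 ?sin_le1. Qed.

Lemma rtrig_vstep a : rtrig (vstep a).
Proof.
by apply: rtrigM; [apply: rtrigB; [exact: rtrig_cst|exact: rtrig_cos]|exact: rtrig_cst].
Qed.

Lemma sin_pi_gt0 x : 0 < x -> x < 1 -> 0 < sin (pi * x).
Proof.
move=> x0 x1; have pp := pi_gt0 R; apply: sin_gt0_pi.
by rewrite mulr_gt0//= gtr_pMr.
Qed.

Lemma vstep_lt0 a x : 0 < x -> x < a -> a <= 1 -> vstep a x < 0.
Proof.
move=> x0 xa a1; rewrite vstepE -opprB mulrN sinN mulrN oppr_lt0.
by apply: mulr_gt0; apply: sin_pi_gt0; lra.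
Qed.

Lemma vstep_gt0 a x : 0 <= a -> a < x -> x < 1 -> 0 < vstep a x.
Proof.
move=> a0 ax x1; rewrite vstepE; by apply: mulr_gt0; apply: sin_pi_gt0; lra.
Qed.

Lemma bernoulli_ge (t : R) n : -1 <= t -> 1 + n%:R * t <= (1 + t) ^+ n.
Proof.
move=> t1; elim: n => [|n IH]; first by rewrite mul0r addr0 expr0.
rewrite exprS; have h : 0 <= 1 + t by lra.
apply: le_trans (ler_wpM2l h IH).
have := mulr_ge0 (ler0n R n) (sqr_ge0 t); rewrite -natr1 expr2; lra.
Qed.

(* The polynomials of Brosowski and Deutsch: on [0, 1] they tend to 1 left of 1/2 and to 0 right of it. *)
Definition bdpoly n (u : R) : R := (1 - u ^+ n) ^+ (2 ^ n).

Lemma bdpoly_01 n u : 0 <= u <= 1 -> 0 <= bdpoly n u <= 1.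
Proof.
move=> /andP[u0 u1]; have h := exprn_ile1 n u0 u1; have h0 := exprn_ge0 n u0.
by rewrite /bdpoly exprn_ge0 ?exprn_ile1//; lra.
Qed.

(** Bernoulli's inequality with exponent 2^n applied to -u^n, since 2^n u^n = (2 u)^n. Informative
    for u < 1/2. *)
Lemma bdpoly_lo n u : 0 <= u <= 1 -> 1 - (2 * u) ^+ n <= bdpoly n u.
Proof.
move=> /andP[u0 u1]; have h := exprn_ile1 n u0 u1; have h0 := exprn_ge0 n u0.
have := @bernoulli_ge (- u ^+ n) (2 ^ n); rewrite /bdpoly => H.
apply: le_trans (H _); last by lra.
by rewrite natrX mulrN -exprMn.
Qed.

(** Bernoulli's inequality gives (2 u)^n <= (1 + u^n)^(2^n), and (1 - u^n) (1 + u^n) <= 1.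
    Informative for u > 1/2. *)
Lemma bdpoly_hi n u : 0 <= u <= 1 -> bdpoly n u * (2 * u) ^+ n <= 1.
Proof.
move=> uu; move: (uu) => /andP[u0 u1]; have h := exprn_ile1 n u0 u1; have h0 := exprn_ge0 n u0.
have /andP[q0 q1] := bdpoly_01 n uu.
have := @bernoulli_ge (u ^+ n) (2 ^ n); rewrite natrX -exprMn => H.
have H1 : (2 * u) ^+ n <= (1 + u ^+ n) ^+ (2 ^ n).
  by apply: le_trans (H _); lra.
apply: le_trans (ler_wpM2l q0 H1) _.
rewrite /bdpoly -exprMn exprn_ile1//.
- by apply: mulr_ge0; lra.
- have := sqr_ge0 (u ^+ n); rewrite expr2; lra.
Qed.

(** The argument lies in [0, 1] and its double is [1 + vstep a x], so the sign of [vstep] decides on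
    which side of the threshold 1/2 it falls. *)
Definition smooth_step a n x := bdpoly n ((1 + vstep a x) / 2).

Lemma rtrig_smooth_step a n : rtrig (smooth_step a n).
Proof.
apply: rtrigX; apply: rtrigB; first exact: rtrig_cst.
apply: rtrigX; apply: rtrigM; last exact: rtrig_cst.
by apply: rtrigD; [exact: rtrig_cst|exact: rtrig_vstep].
Qed.

Lemma half_step_01 a x : 0 <= (1 + vstep a x) / 2 <= 1.
Proof. by have := vstep_le1 a x; rewrite ler_norml => /andP[h1 h2]; apply/andP; split; lra. Qed.

Lemma smooth_step_01 a n x : 0 <= smooth_step a n x <= 1.
Proof. exact: bdpoly_01 (half_step_01 a x). Qed.

Lemma smooth_step_lo a n x : 1 - smooth_step a n x <= (1 + vstep a x) ^+ n.
Proof.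
have := bdpoly_lo n (half_step_01 a x); rewrite -/(smooth_step a n x).
by rewrite mulrCA divff// mulr1; lra.
Qed.

Lemma smooth_step_hi a n x : smooth_step a n x * (1 + vstep a x) ^+ n <= 1.
Proof. by have := bdpoly_hi n (half_step_01 a x); rewrite mulrCA divff// mulr1. Qed.

(** The points 0 and [a] are excluded because [vstep] vanishes there: the argument is then 1/2,
    where the polynomials tend to 1/e. *)
Lemma smooth_step_cvg a x : 0 <= a <= 1 -> U x -> x <> 0 -> x <> a ->
  smooth_step a ^~ x @ \oo --> (\1_`[0, a[%classic x : R).
Proof.
move=> /andP[a0 a1]; rewrite /unit_ico/= in_itv/= => /andP[x0 x1] /eqP nx0 /eqP nxa.
have {}x0 : 0 < x by rewrite lt_neqAle eq_sym nx0.
have /(_ a)/ler_normlP[v1 v2] := vstep_le1 ^~ x.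
rewrite indicE; case: (ltgtP x a) nxa => [xa|ax|//] _.
- have v0 := vstep_lt0 x0 xa a1.
  rewrite mem_set /= ?mulr1n; last by rewrite in_itv/= xa ltW.
  have c : (fun n => 1 - (1 + vstep a x) ^+ n) @ \oo --> (1 - 0 : R).
    by apply: cvgB; [exact: cvg_cst|apply: cvg_expr; rewrite ger0_norm; lra].
  rewrite subr0 in c; apply: (squeeze_cvgr _ c (@cvg_cst _ (1 : R) _ _ _)).
  near=> n; have /andP[_ ->] := smooth_step_01 a n x; rewrite andbT.
  by have := smooth_step_lo a n x; lra.
- have v0 := vstep_gt0 a0 ax x1.
  rewrite memNset /= ?mulr0n; last by rewrite in_itv/= => /andP[_]; lra.
  have c : (fun n => ((1 + vstep a x)^-1) ^+ n) @ \oo --> (0 : R).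
    apply: cvg_expr; rewrite ger0_norm ?invr_ge0; last by lra.
    by rewrite invf_lt1; lra.
  apply: (squeeze_cvgr _ (@cvg_cst _ (0 : R) _ _ _) c); near=> n.
  have /andP[-> _] := smooth_step_01 a n x => /=.
  rewrite exprVn -[leRHS]mul1r ler_pdivlMr; last by apply: exprn_gt0; lra.
  exact: smooth_step_hi.
Unshelve. all: by end_near. Qed.

Lemma ae_and (P Q : R -> Prop) : {ae mu, forall x, P x} -> {ae mu, forall x, Q x} ->
  {ae mu, forall x, P x /\ Q x}.
Proof.
move=> [A [mA A0 sA]] [B [mB B0 sB]]; exists (A `|` B); split.
- exact: (@measurableU _ LT A B mA mB).
- by apply: etrans A0; exact: (@measureU0 _ LT R mu A B mA mB B0).
- by move=> x /= /not_andP[nP|nQ]; [left; exact: sA|right; exact: sB].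
Qed.

Lemma ae_imp (P Q : R -> Prop) : (forall x, P x -> Q x) -> {ae mu, forall x, P x} ->
  {ae mu, forall x, Q x}.
Proof.
move=> PQ [A [mA A0 sA]]; exists A; split; [exact: mA|exact: A0|].
by move=> x /= nQ; apply: sA => /= /PQ.
Qed.

Lemma lmeas_itv (i : interval R) : lmeas [set` i].
Proof. by apply: lmeas_borel; exact: measurable_itv. Qed.

Lemma trig_approx2_step a : 0 <= a <= 1 ->
  trig_approx2 (fun x => \1_`[0, a[%classic (frac x)).
Proof.
move=> a01; have bI : bmp (fun x => \1_`[0, a[%classic (frac x) : R).
  apply: bmp_ind; first exact: lmeas_itv.
  move=> x; rewrite /unit_ico/= !in_itv/= => /andP[-> xa].
  by case/andP: a01 => _; exact: lt_le_trans.
apply: (@trig_approx2_lim (smooth_step a) _ 1 bI) => [n|n x|].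
- by apply: trig_approx2_rtrig; exact: rtrig_smooth_step.
- by have /andP[s0 s1] := smooth_step_01 a n x; rewrite ger0_norm.
- apply: ae_imp (ae_and (ae_neq (R:=R) 0) (ae_neq a)) => x [x0 xa] Ux.
  by rewrite frac_id//; exact: smooth_step_cvg.
Qed.
End SquareApproximation.

(** * From arcs to bounded measurable functions *)

Section Density.
Variable R : realType.
Local Notation I01 := (@Rint01 R).
Local Notation U := (@unit_ico R).
Local Notation mu := (@leb R).
Local Notation LT := (caratheodory_type (R := R) (wlength (@idfun R))^*%mu).
Local Notation frac := (@Defs.frac R).
Implicit Types (a b x : R) (f g h p q : R -> R) (A B : set R).

Lemma lmeasI A B : lmeas A -> lmeas B -> lmeas (A `&` B).
Proof. exact: (@measurableI _ LT). Qed.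

Lemma lmeas_bigcup (F : nat -> set R) : (forall k, lmeas (F k)) -> lmeas (\bigcup_k F k).
Proof. by move=> mF; apply: (@bigcupT_measurable _ LT). Qed.

Lemma trig_approx2_ocitv a b :
  trig_approx2 (fun x => \1_(U `&` `]a, b]%classic) (frac x)).
Proof.
have bI : bmp (fun x => \1_(U `&` `]a, b]%classic) (frac x) : R).
  apply: bmp_ind; last exact: subIsetl.
  by apply: lmeasI; [exact: lmeas_unit|exact: lmeas_ocitv].
have [ba|ab] := leP b a.
  rewrite (_ : (fun x => _) = (fun=> 0)); first by apply: trig_approx2_rtrig; exact: rtrig_cst.
  by apply/funext => x; rewrite set_itv_ge ?setI0 ?indic0// bnd_simp -leNgt.
(* Clamping the endpoints to [0, 1] makes the difference of the two steps the indicator of the part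
   of [a, b[ in [U]; it agrees with the wanted one except perhaps at [a] and [b]. *)
pose c (t : R) : R := Num.min 1 (Num.max 0 t).
have c01 t : 0 <= c t <= 1.
  by rewrite /c le_min ler01 le_max lexx /= ge_min lexx.
have cE (t x : R) : U x -> \1_`[0, c t[%classic x = (x < t)%R%:R :> R.
  rewrite /unit_ico/= in_itv/= => /andP[x0 x1]; rewrite indicE; congr (nat_of_bool _)%:R.
  apply/idP/idP; rewrite inE /= in_itv/= x0 /= /c lt_min x1 lt_max ltNge x0 //=.
pose g x := \1_`[0, c b[%classic (frac x) + (-1) * \1_`[0, c a[%classic (frac x) : R.
apply: (@trig_approx2_ae _ _ g bI).
  apply: trig_approx2D; first exact: trig_approx2_step.
  by apply: trig_approx2M; [apply: trig_approx2_rtrig; exact: rtrig_cst|exact: trig_approx2_step].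
apply: ae_imp (ae_and (ae_neq a) (ae_neq b)) => x [/eqP xa /eqP xb] Ux.
rewrite /g !cE ?frac_id// indicE.
have [ax|xa'] := ltP a x; last first.
  have {}xa' : x < a by rewrite lt_neqAle xa.
  by rewrite xa' (lt_trans xa' ab) memNset /= ?mulr1 ?subrr// in_itv/= => -[_ /andP[]]; lra.
rewrite (ltNge x a) (ltW ax) /= mulr0 addr0; congr (nat_of_bool _)%:R.
have [xb'|bx] := ltP x b; first by rewrite mem_set//=; split => //; rewrite in_itv/= ax ltW.
rewrite memNset//= => -[_]; rewrite in_itv/= => /andP[_ xb'].
by move: xb; rewrite eq_le xb' bx.
Qed.

(** One minus the product of the factors 1 - 1_(F k) is the indicator of a finite union, with no
    disjointness required; at each point these are eventually constant in the number of factors. *)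
Lemma trig_approx2_bigcup (F : nat -> set R) : (forall k, lmeas (F k)) -> (forall k, F k `<=` U) ->
  (forall k, trig_approx2 (fun x => \1_(F k) (frac x))) ->
  trig_approx2 (fun x => \1_(\bigcup_k F k) (frac x)).
Proof.
move=> mF FU aF.
pose P n x : R := \prod_(k < n) (1 - \1_(F k) (frac x)).
have aP n : trig_approx2 (P n).
  elim: n => [|n IH].
    rewrite (_ : P 0%N = fun=> 1); last by apply/funext => x; rewrite /P big_ord0.
    by apply: trig_approx2_rtrig; exact: rtrig_cst.
  rewrite (_ : P n.+1 = fun x => P n x * (1 + (-1) * \1_(F n) (frac x))); last first.
    by apply/funext => x; rewrite /P big_ord_recr /= mulN1r.
  apply: trig_approx2M => //; apply: trig_approx2D.
    by apply: trig_approx2_rtrig; exact: rtrig_cst.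
  by apply: trig_approx2M => //; apply: trig_approx2_rtrig; exact: rtrig_cst.
have P01 n x : 0 <= P n x <= 1.
  apply/andP; split; first by apply: prodr_ge0 => k _; rewrite subr_ge0 indicE lern1 leq_b1.
  apply: prodr_ile1 => k _; rewrite subr_ge0 indicE lern1 leq_b1 /=.
  by rewrite lerBlDr lerDl.
apply: (@trig_approx2_lim _ (fun n x => 1 + (-1) * P n x) _ 1) => [|n|n x|].
- by apply: bmp_ind; [exact: lmeas_bigcup|exact: bigcup_sub].
- apply: trig_approx2D; first by apply: trig_approx2_rtrig; exact: rtrig_cst.
  by apply: trig_approx2M => //; apply: trig_approx2_rtrig; exact: rtrig_cst.
- by have /andP[? ?] := P01 n x; rewrite ger0_norm; lra.
- apply: aeW => x _; rewrite indicE.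
  have [/set_mem[k _ Fk]|/negP nF] := boolP (frac x \in _).
    apply: (@cvg_trans _ ((fun=> 1 : R) @ \oo)); last exact: cvg_cst.
    apply: near_eq_cvg; exists k.+1 => // n /= kn.
    by rewrite /P (bigD1 (Ordinal kn))//= indicE mem_set//= subrr mul0r mulr0 addr0.
  apply: (@cvg_trans _ ((fun=> 0 : R) @ \oo)); last exact: cvg_cst.
  apply: near_eq_cvg; near=> n.
  rewrite /P big1 ?mulr1 ?subrr// => k _; rewrite indicE memNset ?subr0// => Fk.
  by apply: nF; apply/mem_set; exists k.
Unshelve. all: by end_near. Qed.

(** The outer measure provides a countable cover by half-open intervals of total length below mu A +
    eps. Its trace V on [U] contains [A], so the squared error is 1_V - 1_A, of mean mu V - mu A <
    eps. *)
Lemma trig_approx2_lmeas A : lmeas A -> A `<=` U -> trig_approx2 (fun x => \1_A (frac x)).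
Proof.
move=> mA AU; apply: trig_approx2_closed; first exact: bmp_ind.
move=> eps e0.
have muU B : B `<=` U -> (mu B <= 1)%E by move=> BU; rewrite -leb_unit; exact: le_outer_measure.
have fU B : B `<=` U -> mu B \is a fin_num.
  move=> /muU B1; rewrite ge0_fin_numE; last exact: mu_ext_ge0.
  exact: le_lt_trans B1 (ltry _).
have [_ [F [mF AF] <-] hF] := lb_ereal_inf_adherent e0 (fU _ AU).
pose G k := U `&` F k.
have mG k : lmeas (G k).
  apply: lmeasI; first exact: lmeas_unit.
  by have [[a b] _ <-] := mF k; exact: lmeas_ocitv.
have GU k : G k `<=` U by exact: subIsetl.
exists (fun x => \1_(\bigcup_k G k) (frac x)); split.
  apply: trig_approx2_bigcup => // k; rewrite /G.
  by have [[a b] _ <-] := mF k; exact: trig_approx2_ocitv.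
have VU : \bigcup_k G k `<=` U by exact: bigcup_sub.
have mV : lmeas (\bigcup_k G k) by exact: lmeas_bigcup.
have AV : A `<=` \bigcup_k G k by move=> x Ax; have [k _ Fk] := AF _ Ax; exists k => //; split => //; exact: AU.
have -> : (fun x => (\1_A (frac x) - \1_(\bigcup_k G k) (frac x)) ^+ 2) =
    (fun x => \1_(\bigcup_k G k) (frac x) - \1_A (frac x) : R).
  apply/funext => x; rewrite !indicE.
  have [/set_mem/AV/mem_set ->|_] := boolP (frac x \in A); first by rewrite !subrr expr0n.
  by case: (_ \in _); rewrite ?mulr1n ?mulr0n; ring.
rewrite I01B; [|exact: bmp_ind..].
rewrite (I01_frac (\1_(\bigcup_k G k))) (I01_frac (\1_A)) !I01_set//.
rewrite ltrBlDl -lte_fin EFinD !fineK; [|exact: fU..].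
apply: le_lt_trans hF.
apply: (@le_trans _ _ (mu (\bigcup_k F k))).
  by apply: le_outer_measure => x [k _ [_ Fk]]; exists k.
apply: le_trans (outer_measure_sigma_subadditive _ F) _.
apply: lee_nneseries => [k _ _|k _]; first exact: outer_measure_ge0.
by rewrite -[leRHS](@measurable_mu_extE _ R (ocitv_type R) (@wlength R idfun) _ (mF k)).
Qed.

(** The sum counts the positive integers up to both [N] and [y], so it is the integer part of [y]
    once y <= N. *)
Lemma sum_ltn_bounds (N : nat) (y : R) : 0 <= y ->
  \sum_(k < N) (k.+1%:R <= y)%R%:R <= y /\ (y <= N%:R -> y - 1 <= \sum_(k < N) (k.+1%:R <= y)%R%:R).
Proof.
move=> y0.
(* The induction also has to know that the count saturates at [N] while [N] is still at most [y]. *)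
suff H : [/\ \sum_(k < N) (k.+1%:R <= y)%R%:R <= y,
   N%:R <= y -> \sum_(k < N) (k.+1%:R <= y)%R%:R = N%:R :> R &
   y <= N%:R -> y - 1 <= \sum_(k < N) (k.+1%:R <= y)%R%:R] by case: H.
elim: N => [|N [I1 I2 I3]]; first by rewrite !big_ord0; split=> //; lra.
rewrite !big_ord_recr /=; have [Ny|yN] := leP N.+1%:R y.
  have NN : N%:R <= y by apply: le_trans Ny; rewrite ler_nat.
  by rewrite (I2 NN) mulr1n natr1; split=> *; lra.
rewrite mulr0n addr0; split=> [//|yN2|_]; first lra.
have [NN|NN] := leP N%:R y; last exact/I3/ltW.
rewrite (I2 NN); move: yN; rewrite -natr1; lra.
Qed.

Lemma trig_approx2_sum (N : nat) (F : 'I_N -> R -> R) : (forall k, trig_approx2 (F k)) ->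
  trig_approx2 (fun x => \sum_(k < N) F k x).
Proof.
elim: N F => [|N IH] F aF.
  by under eq_fun do rewrite big_ord0; apply: trig_approx2_rtrig; exact: rtrig_cst.
by under eq_fun do rewrite big_ord_recr; apply: trig_approx2D => //; exact: IH.
Qed.

(** After adding a constant to make [h] nonnegative, its integer part at scale 1/(n + 1) is an
    average of indicators of the level sets h >= k/(n + 1), and lies within 1/(n + 1) of [h]. *)
Lemma trig_approx2_bmp h : bmp h -> trig_approx2 h.
Proof.
wlog h0 : h / forall x, 0 <= h x.
  move=> H bh; have [_ [M hM] _] := bh.
  have -> : h = fun x => (h x + M) + - M by apply/funext => x; rewrite addrK.
  apply: trig_approx2D; last by apply: trig_approx2_rtrig; exact: rtrig_cst.
  apply: H; last by apply: bmpD => //; exact: bmp_cst.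
  by move=> x; have /ler_normlP[? ?] := hM x; lra.
move=> bh; have [mh [M hM] ph] := bh.
have M0 : 0 <= M by exact: le_trans (hM 0).
pose S (n k : nat) := U `&` [set x | k.+1%:R <= n.+1%:R * h x].
have mS n k : lmeas (S n k).
  have := mh measurableT `[k.+1%:R / n.+1%:R, +oo[%classic (measurable_itv _).
  rewrite setTI => H; apply: lmeasI; first exact: lmeas_unit.
  rewrite (_ : [set x | _] = h @^-1` `[k.+1%:R / n.+1%:R, +oo[%classic)//.
  by apply/seteqP; split=> x /=; rewrite in_itv/= andbT ler_pdivrMr// mulrC.
(* Enough levels to reach the bound [M], so that no value of [h] is cut off. *)
pose N n := `|Num.ceil (n.+1%:R * M)|%N.
pose g n x : R := n.+1%:R^-1 * \sum_(k < N n) \1_(S n k) (frac x).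
have gE n x : g n x = n.+1%:R^-1 * \sum_(k < N n) (k.+1%:R <= n.+1%:R * h x)%R%:R.
  congr (_ * _); apply: eq_bigr => k _; rewrite indicE; congr (nat_of_bool _)%:R.
  apply/idP/idP; rewrite inE /S /= per_frac//; first by case.
  by move=> H; split=> //; exact: frac_ico.
have gh n x : 0 <= h x - g n x <= n.+1%:R^-1.
  have y0 : 0 <= n.+1%:R * h x by exact: mulr_ge0.
  have [s1 s2] := sum_ltn_bounds (N n) y0.
  have yN : n.+1%:R * h x <= (N n)%:R.
    apply: (@le_trans _ _ (n.+1%:R * M)).
      by rewrite ler_wpM2l// (le_trans (ler_norm _)).
    rewrite /N natr_absz ger0_norm ?ceil_ge//.
    by rewrite ceil_ge0 (lt_le_trans (ltrN10 R))// mulr_ge0.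
  have {}s2 := s2 yN.
  have n0 : 0 < n.+1%:R :> R by [].
  have hE : h x = n.+1%:R^-1 * (n.+1%:R * h x) by rewrite mulKf.
  rewrite gE {1 3}hE -mulrBr mulr_ge0 ?invr_ge0 ?subr_ge0//= -[leRHS]mulr1.
  by rewrite ler_wpM2l ?invr_ge0//; lra.
apply: (@trig_approx2_lim _ g _ M) => // [n|n x|].
- apply: trig_approx2M; first by apply: trig_approx2_rtrig; exact: rtrig_cst.
  by apply: trig_approx2_sum => k; apply: trig_approx2_lmeas; [exact: mS|exact: subIsetl].
- have /andP[g1 _] := gh n x; have /ler_normlP[_ h2] := hM x.
  rewrite ger0_norm; first by lra.
  by rewrite gE mulr_ge0 ?invr_ge0// sumr_ge0.
- apply: aeW => x _; apply/cvgrPdist_le => e e0; near=> n.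
  have /andP[g1 g2] := gh n x; rewrite ger0_norm//; apply: (le_trans g2).
  by rewrite ltW//; near: n; exact: near_infty_natSinv_lt (PosNum e0).
Unshelve. all: by end_near. Qed.

Lemma trig_approx1 h (eps : R) : bmp h -> 0 < eps ->
  exists p, rtrig p /\ I01 (fun x => `|h x - p x|) < eps.
Proof.
move=> bh e0; have [_ /(_ (eps ^+ 2 / 4))[|p [tp hp]]] := trig_approx2_bmp bh.
  by rewrite divr_gt0// exprn_gt0.
exists p; split=> //; have bp := rtrig_bmp tp.
have b1 : bmp (fun x => (h x - p x) ^+ 2) by apply: bmpX; exact: bmpB.
(* From (t - eps / 2)^2 >= 0 one has t <= eps / 4 + t^2 / eps, so a mean-square error below eps^2 /
   4 gives a mean error below eps / 2. *)
apply: (@le_lt_trans _ _ (eps / 4 + eps^-1 * I01 (fun x => (h x - p x) ^+ 2))).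
  rewrite -I01Z// -[eps / 4]I01_cst -I01D; [|exact: bmp_cst|by apply: bmpM => //; exact: bmp_cst].
  apply: le_I01 => [||x _]; first by apply: bmp_norm; exact: bmpB.
    by apply: bmpD; [exact: bmp_cst|by apply: bmpM => //; exact: bmp_cst].
  rewrite -[(h x - p x) ^+ 2]real_normK ?num_real//; set t := `|_|.
  rewrite -subr_ge0 (_ : _ - _ = eps^-1 * (t - eps / 2) ^+ 2); last by field; rewrite gt_eqF.
  by rewrite mulr_ge0 ?sqr_ge0// invr_ge0 ltW.
apply: (@lt_le_trans _ _ (eps / 4 + eps^-1 * (eps ^+ 2 / 4))).
  by rewrite ltrD2l ltr_pM2l// invr_gt0.
by rewrite mulrA expr2 mulKf ?gt_eqF//; lra.
Qed.
End Density.

(** * Symmetric sums over the integers *)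

Definition ssum (V : zmodType) (F : int -> V) (N : nat) : V :=
  \sum_(i < (2 * N + 1)%N) F (i%:Z - N%:Z).

Section SymmetricSums.

Lemma ssum0 (V : zmodType) (F : int -> V) : ssum F 0 = F 0.
Proof. by rewrite /ssum big_ord_recl big_ord0 addr0. Qed.

Lemma ssumS (V : zmodType) (F : int -> V) N :
  ssum F N.+1 = ssum F N + (F N.+1%:Z + F (- N.+1%:Z)).
Proof.
rewrite /ssum (_ : (2 * N.+1 + 1)%N = (2 * N + 1).+2); last by lia.
rewrite big_ord_recl big_ord_recr /= addrCA; congr (_ + _).
  by apply: eq_bigr => i _; congr F; rewrite /bump /=; lia.
rewrite addrC; congr (F _ + F _); rewrite /bump /=; lia.
Qed.

Lemma ssumD (V : zmodType) (F G : int -> V) N : ssum (fun m => F m + G m) N = ssum F N + ssum G N.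
Proof. exact: big_split. Qed.

Lemma ssumB (V : zmodType) (F G : int -> V) N : ssum (fun m => F m - G m) N = ssum F N - ssum G N.
Proof. exact: sumrB. Qed.

Lemma ssumZ (V : pzRingType) (c : V) (F : int -> V) N : ssum (fun m => c * F m) N = c * ssum F N.
Proof. by rewrite /ssum mulr_sumr. Qed.

Lemma ssum_exch (V : zmodType) (F : int -> int -> V) N M :
  ssum (fun m => ssum (F m) M) N = ssum (fun n => ssum (F^~ n) N) M.
Proof. exact: exchange_big. Qed.

Lemma ssum_delta (V : zmodType) (F : int -> V) (m : int) N : (absz m <= N)%N ->
  ssum (fun n => if n == m then F n else 0) N = F m.
Proof.
move=> mN; have h : (absz (m + N%:Z)%R < 2 * N + 1)%N by lia.
rewrite /ssum (bigD1 (Ordinal h))//= big1 ?addr0.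
  have -> : (absz (m + N%:Z))%:Z - N%:Z = m by lia.
  by rewrite eqxx.
move=> i /eqP ih; case: eqP => // im; case: ih; apply: val_inj => /=; lia.
Qed.

Lemma le_ssum (R : numDomainType) (F G : int -> R) N : (forall m, F m <= G m) -> ssum F N <= ssum G N.
Proof. by move=> FG; apply: ler_sum => i _; exact: FG. Qed.

Lemma ssum_ge0 (R : numDomainType) (F : int -> R) N : (forall m, 0 <= F m) -> 0 <= ssum F N.
Proof. by move=> F0; apply: sumr_ge0. Qed.

Lemma ssum_norm (R : numDomainType) (F : int -> R) N : `|ssum F N| <= ssum (fun m => `|F m|) N.
Proof. exact: ler_norm_sum. Qed.

Lemma ssum_incr (R : numDomainType) (F : int -> R) N M : (forall m, 0 <= F m) -> (N <= M)%N ->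
  ssum F N <= ssum F M.
Proof.
move=> F0 /subnK <-; elim: (M - N)%N => // n IH; rewrite addSn ssumS (le_trans IH)//.
by rewrite lerDl addr_ge0.
Qed.

Lemma ssum_tail (R : numDomainType) (F G : int -> R) N M : (forall m, `|F m| <= G m) -> (N <= M)%N ->
  `|ssum F M - ssum F N| <= ssum G M - ssum G N.
Proof.
move=> FG /subnK <-; elim: (M - N)%N => [|n IH]; first by rewrite !subrr normr0.
rewrite addSn !ssumS.
rewrite addrAC [leRHS]addrAC (le_trans (ler_normD _ _))// lerD//.
by rewrite (le_trans (ler_normD _ _))// lerD.
Qed.

Variable R : realType.

(** [F + G] and [G] have nonnegative terms, so their sums are monotone and bounded; the sums of [F]
    are the difference. *)
Lemma ssum_cvg (F G : int -> R) B : (forall m, `|F m| <= G m) -> (forall N, ssum G N <= B) ->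
  cvg (ssum F @ \oo).
Proof.
have H (H : int -> R) C : (forall m, 0 <= H m) -> (forall N, ssum H N <= C) -> cvg (ssum H @ \oo).
  move=> H0 HC; apply: nondecreasing_is_cvgn; first by move=> n m; exact: ssum_incr.
  by exists C => _ [N _ <-].
move=> FG GB.
have G0 m : 0 <= G m by exact: le_trans (FG m).
have -> : ssum F = (fun N => ssum (fun m => F m + G m) N - ssum G N).
  by apply/funext => N; rewrite ssumD addrK.
apply: is_cvgB; last exact: H GB.
apply: (H _ (B + B)) => [m|N].
  by have /ler_normlP[? ?] := FG m; lra.
rewrite ssumD lerD// (le_trans _ (GB N))// le_ssum// => m.
exact: le_trans (ler_norm _) (FG m).
Qed.

Lemma Re_ssum (F : int -> complex R) N : complex.Re (ssum F N) = ssum (fun m => complex.Re (F m)) N.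
Proof. exact: cRe_sum. Qed.
Lemma Im_ssum (F : int -> complex R) N : complex.Im (ssum F N) = ssum (fun m => complex.Im (F m)) N.
Proof. exact: cIm_sum. Qed.
End SymmetricSums.

(** * Parseval's formula *)

Section Parseval.
Variable R : realType.
Local Notation CC := (complex R).
Local Notation I01 := (@Rint01 R).
Local Notation U := (@unit_ico R).
Local Notation Re := (@complex.Re R).
Local Notation Im := (@complex.Im R).
Local Notation "k ^h" := (@tfourier R k) (at level 2).
Implicit Types (s t x : R) (z w : CC) (m n : int) (k l g h p q : R -> CC).

Definition inner g h : CC := cint01 (fun t => g t * conjc (h t)).
Definition norm2 g : R := I01 (fun t => cabs2 (g t)).

Lemma fourierE k m : k^h m = inner k (echar m). Proof. by []. Qed.

Lemma inner_norm2 g : inner g g = Complex (norm2 g) 0.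
Proof. by rewrite /inner -cint_real; congr cint01; apply/funext => t; rewrite cabs2_conj. Qed.

Lemma innerBl g h k : cbmp g -> cbmp h -> cbmp k ->
  inner (fun t => g t - h t) k = inner g k - inner h k.
Proof.
move=> bg bh bk; rewrite /inner; under eq_fun do rewrite mulrBl.
by rewrite cintB//; apply: cbmpM => //; exact: cbmpJ.
Qed.

Lemma innerDl g h k : cbmp g -> cbmp h -> cbmp k ->
  inner (fun t => g t + h t) k = inner g k + inner h k.
Proof.
move=> bg bh bk; rewrite /inner; under eq_fun do rewrite mulrDl.
by rewrite cintD//; apply: cbmpM => //; exact: cbmpJ.
Qed.

Lemma innerZl z g k : cbmp g -> cbmp k -> inner (fun t => z * g t) k = z * inner g k.
Proof.
move=> bg bk; rewrite /inner; under eq_fun do rewrite -mulrA.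
by rewrite cintZ//; apply: cbmpM => //; exact: cbmpJ.
Qed.

Lemma inner_conj g k : cbmp g -> cbmp k -> conjc (inner g k) = inner k g.
Proof.
move=> bg bk; rewrite /inner -cint_conj; last by apply: cbmpM => //; exact: cbmpJ.
by congr cint01; apply/funext => t; rewrite rmorphM /= conjcK mulrC.
Qed.

Lemma inner_ssuml (F : int -> R -> CC) N k : (forall m, cbmp (F m)) -> cbmp k ->
  inner (fun t => ssum (F^~ t) N) k = ssum (fun m => inner (F m) k) N.
Proof.
move=> bF bk; rewrite /inner /ssum; under eq_fun do rewrite mulr_suml.
by rewrite cint_sum// => i; apply: cbmpM => //; exact: cbmpJ.
Qed.

Lemma norm2_ge0 g : 0 <= norm2 g.
Proof. by apply: I01_ge0 => x _; exact: cabs2_ge0. Qed.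

Lemma norm2_shift (c : R) g : cbmp g -> norm2 (fun t => g (t + c)) = norm2 g.
Proof. by move=> bg; apply: (I01_shift c (bmp_cabs2 bg)). Qed.

Lemma inner_echar m n : inner (echar m) (echar n) = if m == n then 1 else 0.
Proof.
rewrite /inner -subr_eq0 -cint_echar; congr cint01; apply/funext => t.
by rewrite echar_conj echar_mul.
Qed.

(* AM-GM with weight [eta], which replaces the Cauchy-Schwarz inequality. *)
Lemma inner_bound g h (eta : R) : cbmp g -> cbmp h -> 0 < eta ->
  `|Re (inner g h)| <= eta^-1 * norm2 g + eta * norm2 h /\
  `|Im (inner g h)| <= eta^-1 * norm2 g + eta * norm2 h.
Proof.
move=> bg bh e0.
have bgh : cbmp (fun t => g t * conjc (h t)) by apply: cbmpM => //; exact: cbmpJ.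
have [bR bI] := bgh.
have b1 : bmp (fun t => eta^-1 * cabs2 (g t)) by apply: bmpM; [exact: bmp_cst|exact: bmp_cabs2].
have b2 : bmp (fun t => eta * cabs2 (h t)) by apply: bmpM; [exact: bmp_cst|exact: bmp_cabs2].
have amgm (a b : R) : `|a * b| <= eta^-1 * a ^+ 2 + eta * b ^+ 2.
  apply: (@le_trans _ _ (eta^-1 / 2 * a ^+ 2 + eta / 2 * b ^+ 2)); last first.
    rewrite lerD// ler_wpM2r ?sqr_ge0//; first by rewrite ler_pdivrMr// ler_peMr ?invr_ge0 ?ltW// ltr1n.
    by rewrite ler_pdivrMr// ler_peMr ?ltW// ltr1n.
  rewrite normrM -[a ^+ 2]real_normK ?num_real// -[b ^+ 2]real_normK ?num_real//.
  rewrite -subr_ge0 (_ : _ - _ = eta^-1 / 2 * (`|a| - eta * `|b|) ^+ 2).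
    by rewrite mulr_ge0 ?sqr_ge0// divr_ge0// invr_ge0 ltW.
  by field; rewrite gt_eqF.
rewrite /norm2 -!I01Z; [|exact: bmp_cabs2..].
rewrite -I01D//; split.
- apply: le_trans (I01_norm bR) _; apply: le_I01 => [||t _]; [exact: bmp_norm|exact: bmpD|].
  rewrite /= !ReImE mulrN opprK (le_trans (ler_normD _ _))// /cabs2.
  have := amgm (Re (g t)) (Re (h t)); have := amgm (Im (g t)) (Im (h t)); lra.
- apply: le_trans (I01_norm bI) _; apply: le_I01 => [||t _]; [exact: bmp_norm|exact: bmpD|].
  rewrite /= !ReImE mulrN (le_trans (ler_normD _ _))// normrN /cabs2.
  have := amgm (Re (g t)) (Im (h t)); have := amgm (Im (g t)) (Re (h t)); lra.
Qed.

Definition fpartial k N x : CC := ssum (fun m => k^h m * echar m x) N.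

Lemma cbmp_fpartial k N : cbmp (fpartial k N).
Proof. by apply: cbmp_sum => i; apply: cbmpZ; exact: cbmp_echar. Qed.

Lemma trig_fpartial_eq p : trig p -> exists N0, forall N, (N0 <= N)%N -> fpartial p N = p.
Proof.
elim=> [z m|p1 p2 t1 [N1 IH1] t2 [N2 IH2]].
  exists (absz m) => N mN; apply/funext => x; rewrite /fpartial.
  rewrite -(ssum_delta (fun n => z * echar n x) mN); congr (ssum _ N); apply/funext => n.
  rewrite fourierE innerZl ?inner_echar; [|exact: cbmp_echar..].
  by rewrite eq_sym; case: eqVneq => [->|]; rewrite ?mulr1// mulr0 mul0r.
exists (maxn N1 N2) => N; rewrite geq_max => /andP[h1 h2]; apply/funext => x.
rewrite -[in RHS](IH1 _ h1) -[in RHS](IH2 _ h2) /fpartial -ssumD; congr (ssum _ N).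
apply/funext => m; rewrite -mulrDl !fourierE innerDl//; [exact: trig_cbmp..|exact: cbmp_echar].
Qed.

(** Pythagoras: the residual is orthogonal to the characters of index at most [N], hence to the
    partial sum itself. *)
Lemma norm2_sub_fpartial k N : cbmp k ->
  norm2 (fun t => k t - fpartial k N t) = norm2 k - ssum (fun m => cabs2 (k^h m)) N.
Proof.
move=> bk; set S := fpartial k N; have bS : cbmp S by exact: cbmp_fpartial.
have bkS : cbmp (fun t => k t - S t) by exact: cbmpB.
have SE h : cbmp h -> inner S h = ssum (fun m => k^h m * inner (echar m) h) N.
  move=> bh; rewrite /S /fpartial (@inner_ssuml (fun m t => k^h m * echar m t))//.
    by congr (ssum _ N); apply/funext => m; rewrite innerZl//; exact: cbmp_echar.
  by move=> m; apply: cbmpZ; exact: cbmp_echar.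
have orth m : (absz m <= N)%N -> inner (fun t => k t - S t) (echar m) = 0.
  move=> mN; rewrite innerBl ?SE//; [|exact: cbmp_echar..].
  rewrite (_ : ssum _ N = k^h m) ?subrr//.
  rewrite -(ssum_delta (k^h) mN); congr (ssum _ N); apply/funext => n.
  by rewrite inner_echar; case: eqVneq; rewrite ?mulr1 ?mulr0.
have orthS : inner (fun t => k t - S t) S = 0.
  rewrite -inner_conj// SE// /ssum big1 ?rmorph0// => i _.
  rewrite -inner_conj//; last exact: cbmp_echar.
  by rewrite orth ?rmorph0 ?mulr0//; have := ltn_ord i; lia.
have : inner (fun t => k t - S t) (fun t => k t - S t) = inner k k - inner S k.
  rewrite -inner_conj// innerBl// -(inner_conj bkS bS) orthS.
  by rewrite rmorph0 subr0 inner_conj// innerBl.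
rewrite SE// => /(congr1 Re); rewrite !inner_norm2 !ReImE /= Re_ssum => ->.
congr (_ - ssum _ N); apply/funext => m.
by rewrite -inner_conj ?fourierE//; [rewrite -cabs2_conj|exact: cbmp_echar].
Qed.

Lemma bessel k N : cbmp k -> ssum (fun m => cabs2 (k^h m)) N <= norm2 k.
Proof. by move=> bk; rewrite -subr_ge0 -norm2_sub_fpartial// norm2_ge0. Qed.

Lemma ctrig_approx2 k (eps : R) : cbmp k -> 0 < eps ->
  exists p, trig p /\ norm2 (fun t => k t - p t) < eps.
Proof.
move=> [rk ik] e0; have e2 : 0 < eps / 2 by rewrite divr_gt0.
have [_ /(_ _ e2)[p [tp kp]]] := trig_approx2_bmp rk.
have [_ /(_ _ e2)[q [tq kq]]] := trig_approx2_bmp ik.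
exists (fun x => Complex (p x) 0 + Complex 0 1 * Complex (q x) 0); split.
  by apply: trig_add => //; apply: trigM => //; exact: trig_cst.
have bp := rtrig_bmp tp; have bq := rtrig_bmp tq.
rewrite /norm2 (_ : (fun t => _) = fun t => (Re (k t) - p t) ^+ 2 + (Im (k t) - q t) ^+ 2).
  rewrite I01D; first by move: kp kq => /=; lra.
  - by apply: bmpX; apply: bmpB.
  - by apply: bmpX; apply: bmpB.
by apply/funext => t; rewrite /cabs2 !ReImE /=; ring.
Qed.

(** Beyond the degree of an approximating [p], the functions [k] and [k - p] have the same residual,
    and passing to the residual does not increase [norm2]. *)
Lemma norm2_fpartial_cvg k (eps : R) : cbmp k -> 0 < eps ->
  exists N0, forall N, (N0 <= N)%N -> norm2 (fun t => k t - fpartial k N t) <= eps.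
Proof.
move=> bk e0; have [p [tp kp]] := ctrig_approx2 bk e0.
have bp := trig_cbmp tp; have bkp : cbmp (fun t => k t - p t) by exact: cbmpB.
have [N0 pN] := trig_fpartial_eq tp; exists N0 => N NN; apply: le_trans (ltW kp).
have -> : (fun t => k t - fpartial k N t) =
    (fun t => (k t - p t) - fpartial (fun t => k t - p t) N t).
  apply/funext => t.
  suff -> : fpartial (fun t => k t - p t) N t = fpartial k N t - fpartial p N t by rewrite pN//; ring.
  rewrite /fpartial -ssumB; congr (ssum _ N); apply/funext => m.
  by rewrite -mulrBl !fourierE innerBl//; exact: cbmp_echar.
by rewrite norm2_sub_fpartial// gerBl ssum_ge0// => m; exact: cabs2_ge0.
Qed.

(** The difference between [S] and a partial sum is the inner product of the translated residual of
    [k] with [k], and translation leaves the [norm2] of the residual unchanged. *)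
Lemma parseval k s : cbmp k ->
  let G := fun m => Complex (cabs2 (k^h m)) 0 * echar m s in
  let S := inner (fun t => k (t + s)) k in
  (fun N => Re (ssum G N)) @ \oo --> Re S /\ (fun N => Im (ssum G N)) @ \oo --> Im S.
Proof.
move=> bk G S.
have key (eps : R) : 0 < eps -> exists N0, forall N, (N0 <= N)%N ->
    `|Re S - Re (ssum G N)| <= eps /\ `|Im S - Im (ssum G N)| <= eps.
  move=> e0; have k0 := norm2_ge0 k.
  (* Chosen so that eta * norm2 k <= eps / 2, with [+ 1] keeping the denominator positive; the
     residual is then asked to have [norm2] at most eta * (eps / 2). *)
  pose eta := eps / 2 / (norm2 k + 1).
  have eta0 : 0 < eta by rewrite !divr_gt0// ltr_wpDl.
  have [N0 H] := norm2_fpartial_cvg bk (mulr_gt0 eta0 (divr_gt0 e0 (ltr0Sn R 1))).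
  exists N0 => N /H {}H; pose D t := k t - fpartial k N t.
  have bD : cbmp D by apply: cbmpB => //; exact: cbmp_fpartial.
  have bDs : cbmp (fun t => D (t + s)) by exact: cbmp_shift.
  have SG : S - ssum G N = inner (fun t => D (t + s)) k.
    rewrite /D innerBl//; [|exact: cbmp_shift|exact/cbmp_shift/cbmp_fpartial].
    congr (_ - _); rewrite /fpartial (@inner_ssuml (fun m t => k^h m * echar m (t + s)))//.
      congr (ssum _ N); apply/funext => m; rewrite innerZl//; last exact/cbmp_shift/cbmp_echar.
      rewrite [inner _ k](_ : _ = echar m s * inner (echar m) k); last first.
        rewrite -innerZl//; last exact: cbmp_echar.
        by congr inner; apply/funext => t; rewrite echar_add mulrC.
      by rewrite -inner_conj//; [rewrite /G cabs2_conj fourierE; ring|exact: cbmp_echar].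
    by move=> m; apply: cbmpZ; exact/cbmp_shift/cbmp_echar.
  have [b1 b2] := inner_bound bDs bk eta0.
  rewrite norm2_shift// in b1 b2.
  have h1 : eta^-1 * norm2 D <= eps / 2.
    by rewrite mulrC ler_pdivrMr// mulrC.
  have h2 : eta * norm2 k <= eps / 2.
    by rewrite /eta mulrAC ler_pdivrMr ?ltr_wpDl// ler_pM2l ?divr_gt0// lerDl.
  rewrite -SG in b1 b2; rewrite -!cReN -cReD -cImN -cImD; split.
    by apply: le_trans b1 _; lra.
  by apply: le_trans b2 _; lra.
by split; apply/cvgrPdist_le => eps /key[N0 H]; exists N0 => // N /= /H[].
Qed.

End Parseval.

(** * Diffraction *)

Section Diffraction.
Variable R : realType.
Local Notation CC := (complex R).
Local Notation I01 := (@Rint01 R).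
Local Notation U := (@unit_ico R).
Local Notation Re := (@complex.Re R).
Local Notation Im := (@complex.Im R).
Local Notation frac := (@Defs.frac R).
Local Notation "k ^h" := (@tfourier R k) (at level 2).
Implicit Types (s t x : R) (z w : CC) (m n : int) (a b c : int -> R) (k l X Y : R -> CC).

Definition epartial a N s : CC := ssum (fun m => Complex (a m) 0 * echar m s) N.

(** Convergence is required at every point, not almost everywhere, because [Y] is later evaluated at
    the multiples of alpha. *)
Definition expansion a Y : Prop :=
  [/\ forall m, 0 <= a m, exists B, forall N, ssum a N <= B &
      forall s, (fun N => Re (epartial a N s)) @ \oo --> Re (Y s) /\
                (fun N => Im (epartial a N s)) @ \oo --> Im (Y s)].

Lemma Re_term (r : R) z : Re (Complex r 0 * z) = r * Re z.
Proof. by rewrite cReM /= mul0r subr0. Qed.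
Lemma Im_term (r : R) z : Im (Complex r 0 * z) = r * Im z.
Proof. by rewrite cImM /= mul0r addr0. Qed.

Lemma echar_ReIm_le1 m s : `|Re (echar m s)| <= 1 /\ `|Im (echar m s)| <= 1.
Proof. by split; rewrite ler_norml /= ?cos_geN1 ?cos_le1 ?sin_geN1 ?sin_le1. Qed.

Lemma epartial_term_le a m s : 0 <= a m ->
  `|Re (Complex (a m) 0 * echar m s)| <= a m /\ `|Im (Complex (a m) 0 * echar m s)| <= a m.
Proof.
move=> a0; have [h1 h2] := echar_ReIm_le1 m s.
by rewrite Re_term Im_term !normrM (ger0_norm a0) -{2 4}[a m]mulr1 !ler_wpM2l.
Qed.

Lemma cbmp_epartial a N : cbmp (epartial a N).
Proof. by apply: cbmp_sum => i; apply: cbmpZ; exact: cbmp_echar. Qed.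

Lemma epartial_le a N s : (forall m, 0 <= a m) ->
  `|Re (epartial a N s)| <= ssum a N /\ `|Im (epartial a N s)| <= ssum a N.
Proof.
move=> a0; rewrite Re_ssum Im_ssum; split; apply: le_trans (ssum_norm _ _) _;
  by apply: le_ssum => m; have [] := epartial_term_le s (a0 m).
Qed.

Lemma expansion_bound a Y : expansion a Y ->
  exists2 B, 0 <= B & (forall N, ssum a N <= B) /\ forall s, `|Re (Y s)| <= B /\ `|Im (Y s)| <= B.
Proof.
move=> [a0 [B aB] hY]; exists B; first by apply: le_trans (aB 0%N); exact: ssum_ge0.
split=> // s; have [/cvg_norm h1 /cvg_norm h2] := hY s.
split.
- apply: (ler_cvg_to h1 (cvg_cst B)); near=> N; rewrite /=.
  by have [h _] := epartial_le N s a0; exact: le_trans h (aB N).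
- apply: (ler_cvg_to h2 (cvg_cst B)); near=> N; rewrite /=.
  by have [_ h] := epartial_le N s a0; exact: le_trans h (aB N).
Unshelve. all: by end_near. Qed.

(** Characters have modulus one, so the tail of the sum of [a] bounds the remainder uniformly in
    [s]. *)
Lemma expansion_tail a Y : expansion a Y -> exists tau : nat -> R,
  tau @ \oo --> 0 /\ forall N s,
    `|Re (Y s) - Re (epartial a N s)| <= tau N /\ `|Im (Y s) - Im (epartial a N s)| <= tau N.
Proof.
move=> [a0 [B aB] hY].
have ca : cvg (ssum a @ \oo) by apply: (ssum_cvg _ aB) => m; rewrite ger0_norm.
pose L := lim (ssum a @ \oo); exists (fun N => L - ssum a N); split.
  by rewrite -(subrr L); apply: cvgB => //; exact: cvg_cst.
move=> N s; have [h1 h2] := hY s.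
have tl (F : int -> R) : (forall m, `|F m| <= a m) -> forall y, ssum F @ \oo --> y ->
    `|y - ssum F N| <= L - ssum a N.
  move=> Fa y Fy.
  have c1 : (fun M => `|ssum F M - ssum F N|) @ \oo --> `|y - ssum F N|.
    by apply: cvg_norm; apply: cvgB => //; exact: cvg_cst.
  have c2 : (fun M => ssum a M - ssum a N) @ \oo --> L - ssum a N.
    by apply: cvgB => //; exact: cvg_cst.
  apply: (ler_cvg_to c1 c2); near=> M; apply: ssum_tail => //.
  by near: M; exact: nbhs_infty_ge.
rewrite !Re_ssum !Im_ssum; split.
- apply: tl => [m|]; first by have [] := epartial_term_le s (a0 m).
  by move: h1; under eq_fun do rewrite Re_ssum.
- apply: tl => [m|]; first by have [] := epartial_term_le s (a0 m).
  by move: h2; under eq_fun do rewrite Im_ssum.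
Unshelve. all: by end_near. Qed.

Lemma expansion_cbmp a Y : expansion a Y -> cbmp Y.
Proof.
move=> aY; have [a0 [B aB] hY] := aY; split.
- apply: (@bmp_lim _ (fun N s => Re (epartial a N s)) _ B) => [N|N s|s].
  + by have [] := cbmp_epartial a N.
  + by have [h _] := epartial_le N s a0; exact: le_trans h (aB N).
  + by have [] := hY s.
- apply: (@bmp_lim _ (fun N s => Im (epartial a N s)) _ B) => [N|N s|s].
  + by have [] := cbmp_epartial a N.
  + by have [_ h] := epartial_le N s a0; exact: le_trans h (aB N).
  + by have [] := hY s.
Qed.

Lemma fourier_epartial a N n : (absz n <= N)%N -> (epartial a N)^h n = Complex (a n) 0.
Proof.
move=> nN; rewrite fourierE /epartial (@inner_ssuml _ (fun m t => Complex (a m) 0 * echar m t)).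
- rewrite -(ssum_delta (fun m => Complex (a m) 0) nN); congr (ssum _ N); apply/funext => m.
  rewrite innerZl; [|exact: cbmp_echar..].
  by rewrite inner_echar; case: eqVneq; rewrite ?mulr1 ?mulr0.
- by move=> m; apply: cbmpZ; exact: cbmp_echar.
- exact: cbmp_echar.
Qed.

Lemma le_cvg0_eq0 (y : R) (tau : nat -> R) : tau @ \oo --> 0 ->
  (\forall N \near \oo, `|y| <= tau N) -> y = 0.
Proof.
move=> t0 h; apply/eqP; rewrite -normr_le0.
exact: (ler_cvg_to (cvg_cst _) t0 h).
Qed.

(** The partial sums have the right coefficient as soon as N >= |n|, and uniform convergence carries
    this to the limit. The factor 2 comes from the two real products in each part of a complex
    product. *)
Lemma expansion_fourier a Y n : expansion a Y -> Y^h n = Complex (a n) 0.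
Proof.
move=> aY; have bY := expansion_cbmp aY; have [tau [t0 ht]] := expansion_tail aY.
have t20 : (fun N => 2 * tau N) @ \oo --> (0 : R).
  by rewrite -(mulr0 2); apply: cvgM => //; exact: cvg_cst.
have key N : (absz n <= N)%N ->
  `|Re (Y^h n - Complex (a n) 0)| <= 2 * tau N /\ `|Im (Y^h n - Complex (a n) 0)| <= 2 * tau N.
  move=> nN; rewrite -(fourier_epartial a nN) !fourierE -innerBl//; last 2 first.
  - exact: cbmp_epartial.
  - exact: cbmp_echar.
  have bD : cbmp (fun t => Y t - epartial a N t) by apply: cbmpB => //; exact: cbmp_epartial.
  have [bR bI] : cbmp (fun t => (Y t - epartial a N t) * conjc (echar n t)).
    by apply: cbmpM => //; apply: cbmpJ; exact: cbmp_echar.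
  have pt (p q r u : R) : `|p| <= tau N -> `|q| <= tau N -> `|r| <= 1 -> `|u| <= 1 ->
      `|p * r + q * u| <= 2 * tau N.
    move=> hp hq hr hu; rewrite (le_trans (ler_normD _ _))// !normrM mulr_natl mulr2n.
    by rewrite lerD// -[leRHS]mulr1 ler_pM.
  split.
    apply: (I01_bound bR) => t _ /=; rewrite !ReImE mulrN opprK.
    by have [h1 h2] := ht N t; have [h3 h4] := echar_ReIm_le1 n t; exact: pt.
  apply: (I01_bound bI) => t _ /=; rewrite !ReImE.
  have [h1 h2] := ht N t; have [h3 h4] := echar_ReIm_le1 n t.
  by apply: pt; rewrite ?normrN.
apply/eqP; rewrite -subr_eq0; apply/eqP; apply: complexP; apply: (le_cvg0_eq0 t20);
  by exists (absz n) => // N /= /key[].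
Qed.

(** Both [u N] and [v N] are compared with one square partial sum [D N] of the double series:
    replacing [X] by its partial sum costs at most [B * tc N], replacing [Y] costs at most
    [C * tb N]. *)
Lemma expansion_exchange b c X Y (alpha : R) : expansion b Y -> expansion c X ->
  let u := ssum (fun n => Complex (b n) 0 * X (n%:~R * alpha)) in
  let v := ssum (fun m => Complex (c m) 0 * Y (m%:~R * alpha)) in
  exists S : CC, [/\ (fun N => Re (u N)) @ \oo --> Re S, (fun N => Im (u N)) @ \oo --> Im S,
    (fun N => Re (v N)) @ \oo --> Re S & (fun N => Im (v N)) @ \oo --> Im S].
Proof.
move=> bY cX u v.
have [b0 _ _] := bY; have [c0 _ _] := cX.
have [B B0 [bB YB]] := expansion_bound bY; have [C C0 [cC XC]] := expansion_bound cX.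
have [tb [tb0 htb]] := expansion_tail bY; have [tc [tc0 htc]] := expansion_tail cX.
pose D N := ssum (fun n => Complex (b n) 0 * epartial c N (n%:~R * alpha)) N.
(* The terms are symmetric because the character of index m at n alpha equals the character of index
   n at m alpha. *)
have D2 N : D N = ssum (fun m => Complex (c m) 0 * epartial b N (m%:~R * alpha)) N.
  rewrite /D /epartial.
  transitivity (ssum (fun n => ssum (fun m => Complex (b n) 0 * (Complex (c m) 0 * echar m (n%:~R * alpha))) N) N).
    by congr (ssum _ N); apply/funext => n; rewrite ssumZ.
  rewrite ssum_exch; congr (ssum _ N); apply/funext => m; rewrite -ssumZ; congr (ssum _ N).
  apply/funext => n; rewrite mulrCA; congr (_ * (_ * _)); rewrite /echar; congr cexp2pi; exact: mulrCA.
have dif a (G H : int -> CC) (A : R) (tau : R) N : (forall m, 0 <= a m) -> ssum a N <= A ->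
    (forall m, `|Re (G m) - Re (H m)| <= tau /\ `|Im (G m) - Im (H m)| <= tau) ->
    `|Re (ssum (fun m => Complex (a m) 0 * G m) N) - Re (ssum (fun m => Complex (a m) 0 * H m) N)| <= A * tau /\
    `|Im (ssum (fun m => Complex (a m) 0 * G m) N) - Im (ssum (fun m => Complex (a m) 0 * H m) N)| <= A * tau.
  move=> a0 aA GH; have tau0 : 0 <= tau by have [h _] := GH 0; exact: le_trans h.
  have hA : ssum (fun m => tau * a m) N <= A * tau by rewrite ssumZ mulrC ler_wpM2r.
  rewrite !Re_ssum !Im_ssum -!ssumB; split; apply: le_trans (ssum_norm _ _) _;
    apply: le_trans hA; apply: le_ssum => m; have [h1 h2] := GH m.
  - by rewrite !Re_term -mulrBr normrM ger0_norm// mulrC ler_wpM2r.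
  - by rewrite !Im_term -mulrBr normrM ger0_norm// mulrC ler_wpM2r.
have du N := dif b (fun n => X (n%:~R * alpha)) (fun n => epartial c N (n%:~R * alpha)) B (tc N) N b0 (bB N) (fun m => htc N _).
have dv N := dif c (fun n => Y (n%:~R * alpha)) (fun n => epartial b N (n%:~R * alpha)) C (tb N) N c0 (cC N) (fun m => htb N _).
have cvgu (T : CC -> R) : (T = Re \/ T = Im) ->
   cvg ((fun N => T (u N)) @ \oo).
  move=> hT; rewrite (_ : (fun N => _) = ssum (fun n => T (Complex (b n) 0 * X (n%:~R * alpha)))); last first.
    by apply/funext => N; case: hT => ->; rewrite /u ?Re_ssum ?Im_ssum.
  apply: (@ssum_cvg _ _ (fun n => C * b n) (C * B)) => [n|N]; last by rewrite ssumZ ler_wpM2l.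
  have [h1 h2] := XC (n%:~R * alpha).
  by case: hT => ->; rewrite ?Re_term ?Im_term normrM ger0_norm// mulrC ler_wpM2r.
have cR := cvgu Re (or_introl erefl); have cI := cvgu Im (or_intror erefl).
pose S := Complex (lim ((fun N => Re (u N)) @ \oo)) (lim ((fun N => Im (u N)) @ \oo)).
have to0 (p q d : nat -> R) : (forall N, `|p N - d N| <= B * tc N) -> (forall N, `|q N - d N| <= C * tb N) ->
    forall y : R, p @ \oo --> y -> q @ \oo --> y.
  move=> pd qd y py.
  have w0 : (fun N => B * tc N + C * tb N) @ \oo --> (0 : R).
    rewrite [X in _ --> X](_ : _ = B * 0 + C * 0); last by rewrite !mulr0 addr0.
    by apply: cvgD; apply: cvgM => //; exact: cvg_cst.
  have c1 : (fun N => p N - (B * tc N + C * tb N)) @ \oo --> y.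
    by rewrite -[X in _ --> X](subr0 y); exact: cvgB.
  have c2 : (fun N => p N + (B * tc N + C * tb N)) @ \oo --> y.
    by rewrite -[X in _ --> X](addr0 y); exact: cvgD.
  apply: (squeeze_cvgr _ c1 c2); near=> N.
  have /ler_normlP[h1 h2] := pd N; have /ler_normlP[h3 h4] := qd N.
  by apply/andP; split; lra.
exists S; split => //.
- apply: (to0 (fun N => Re (u N)) _ (fun N => Re (D N))) => // N; first by have [] := du N.
  by rewrite D2; have [] := dv N.
- apply: (to0 (fun N => Im (u N)) _ (fun N => Im (D N))) => // N; first by have [] := du N.
  by rewrite D2; have [] := dv N.
Unshelve. all: by end_near. Qed.

Lemma cabs_le z : cabs z <= `|Re z| + `|Im z|.
Proof.
rewrite /cabs -[leRHS]ger0_norm ?addr_ge0// -sqrtr_sqr ler_sqrt ?sqr_ge0// /cabs2.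
rewrite -[Re z ^+ 2]real_normK ?num_real// -[Im z ^+ 2]real_normK ?num_real//.
have := mulr_ge0 (normr_ge0 (Re z)) (normr_ge0 (Im z)); rewrite !expr2; lra.
Qed.

Lemma expansion_abs_summable b c X Y (alpha : R) : expansion b Y -> expansion c X ->
  exists B : R, forall N, ssum (fun n => cabs (Complex (b n) 0 * X (n%:~R * alpha))) N <= B.
Proof.
move=> bY cX; have [b0 [B bB] _] := bY; have [C C0 [cC XC]] := expansion_bound cX.
exists (2 * C * B) => N.
apply: (@le_trans _ _ (ssum (fun n => 2 * C * b n) N)); last by rewrite ssumZ ler_wpM2l// mulr_ge0.
apply: le_ssum => n; apply: le_trans (cabs_le _) _.
have [h1 h2] := XC (n%:~R * alpha).
rewrite Re_term Im_term !normrM ger0_norm// -mulrDr mulrC ler_wpM2r//; lra.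
Qed.

Lemma parseval_expansion k : cbmp k ->
  expansion (fun m => cabs2 (k^h m)) (fun s => inner (fun t => k (t + s)) k).
Proof.
move=> bk; split; first by move=> m; exact: cabs2_ge0.
- by exists (norm2 k) => N; exact: bessel.
- by move=> s; exact: parseval.
Qed.

(** With k(t) = conj (l (-t)) the convolution of l with its reflection becomes a correlation of k
    with itself, the form to which Parseval's formula applies. The integrands match after the
    substitution t -> t - s. *)
Lemma tconv_inner l s : cbmp (fun t => conjc (l (- t))) ->
  tconv l (ctilde l) s = inner (fun t => conjc (l (- (t + s)))) (fun t => conjc (l (- t))).
Proof.
move=> bk; rewrite /tconv /ctilde /inner.
rewrite -(cint_shift (- s) (k := fun t => conjc (l (- (t + s))) * conjc (conjc (l (- t))))).
  by congr cint01; apply/funext => t; rewrite !subrK conjcK opprD opprK [- t + s]addrC mulrC.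
by apply: cbmpM; [exact: (cbmp_shift s bk)|exact: cbmpJ].
Qed.

Lemma cbmp_cont_reflect (lr li : R -> R) : cont_periodic lr -> cont_periodic li ->
  cbmp (fun t => conjc (Complex (lr (- t)) (li (- t)))).
Proof.
have H (h : R -> R) : cont_periodic h -> bmp (fun t => h (- t)).
  move=> [ch ph]; apply: bmp_per_cont; split.
    by move=> t; apply: continuous_comp; [exact: opp_continuous|exact: ch].
  by move=> t; rewrite -(ph (- (t + 1))) opprD subrK.
by move=> hr hi; apply: cbmpJ; split; exact: H.
Qed.

Variables (f : R -> R) (alpha : R).
Let F x := f (frac x).
Let K x := Complex (F x) 0.

Lemma fhat_fourier m : fhat f m = K^h m.
Proof.
rewrite /fhat /tfourier; apply: complexP => /=; apply: eq_I01 => x Ux;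
  by rewrite /K /F frac_id.
Qed.

Hypothesis bF : bmp F.
Let bK : cbmp K. Proof. exact: cbmp_real. Qed.

Lemma Xi_mean n : Xi f alpha n = Rint01 (fun x => F (x - n%:~R * alpha) * F x).
Proof.
by apply: eq_I01 => x Ux; rewrite /Tpow mulrNz mulNr /F (frac_id Ux).
Qed.

(** By invariance of the mean, [Xi] gives the Gram matrix of the translates of [K]; positive
    definiteness follows, the quadratic form being the [norm2] of a combination of translates. *)
Lemma Xi_inner m n : Complex (Xi f alpha (m - n)) 0 =
  inner (fun t => K (t + m%:~R * alpha)) (fun t => K (t + n%:~R * alpha)).
Proof.
rewrite /inner -(cint_shift (- (m%:~R * alpha))) ; last first.
  by apply: cbmpM; [|apply: cbmpJ]; exact: cbmp_shift.
rewrite Xi_mean -cint_real; congr cint01; apply/funext => x.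
rewrite subrK.
have -> : x - m%:~R * alpha + n%:~R * alpha = x - (m - n)%:~R * alpha.
  by rewrite rmorphB /=; ring.
by apply: complexP; rewrite !ReImE /=; ring.
Qed.

Lemma Xi_inner0 n : Complex (Xi f alpha n) 0 = inner (fun t => K (t + n%:~R * alpha)) K.
Proof.
rewrite -[n in LHS]subr0 Xi_inner; congr inner; apply/funext => t.
by rewrite mul0r addr0.
Qed.

Lemma Xi_positive_definite : positive_definite (Xi f alpha).
Proof.
move=> k c zs /=.
pose G t := \sum_(i < k) c i * K (t + (zs i)%:~R * alpha).
have bG : cbmp G by apply: cbmp_sum => i; apply: cbmpZ; exact: cbmp_shift.
suff -> : \sum_(i < k) \sum_(j < k) c i * conjc (c j) * Complex (Xi f alpha (zs i - zs j)) 0 = inner G G.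
  by rewrite inner_norm2 /=; split=> //; exact: norm2_ge0.
rewrite /inner [RHS](_ : _ = cint01 (fun t => \sum_(i < k) \sum_(j < k)
   (c i * conjc (c j)) * (K (t + (zs i)%:~R * alpha) * conjc (K (t + (zs j)%:~R * alpha))))); last first.
  congr cint01; apply/funext => t; rewrite /G rmorph_sum mulr_suml; apply: eq_bigr => i _.
  by rewrite mulr_sumr; apply: eq_bigr => j _; rewrite rmorphM /=; ring.
have bKK i j : cbmp (fun t => K (t + (zs i)%:~R * alpha) * conjc (K (t + (zs j)%:~R * alpha))).
  by apply: cbmpM; [|apply: cbmpJ]; exact: cbmp_shift.
rewrite cint_sum; last by move=> i; apply: cbmp_sum => j; exact: cbmpZ.
apply: eq_bigr => i _; rewrite cint_sum; last by move=> j; exact: cbmpZ.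
by apply: eq_bigr => j _; rewrite cintZ// Xi_inner.
Qed.

(** Two correlations are paired. That of [K] has coefficients |K^(m)|^2 and takes the value Xi(n) at
    n alpha; [phi] is that of the reflected conjugate of [l], with coefficients b(n). The two sides
    of the formula are then the two sums of [expansion_exchange]. *)
Theorem Xi_diffraction :
  is_diffraction (Xi f alpha) (fun m => cabs2 (fhat f m)) (fun m => m%:~R * alpha).
Proof.
have cE : (fun m => cabs2 (fhat f m)) = (fun m => cabs2 (K^h m)).
  by apply/funext => m; rewrite fhat_fourier.
rewrite cE; have eK := parseval_expansion bK.
split; first exact: Xi_positive_definite.
split.
  have [B B0 [_ KB]] := expansion_bound eK; exists B => n.
  by have [h _] := KB (n%:~R * alpha); rewrite -Xi_inner0 in h.
split; first by move=> m; exact: cabs2_ge0.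
split; first by exists (norm2 K) => N; exact: bessel.
move=> lr li hr hi l phi.
have bk := cbmp_cont_reflect hr hi; set k := fun t => _ in bk.
pose b m := cabs2 (k^h m).
have eb : expansion b phi.
  have := parseval_expansion bk; rewrite (_ : (fun s => inner _ _) = phi)//.
  by apply/funext => s; rewrite /phi tconv_inner.
have [S [h1 h2 h3 h4]] := expansion_exchange alpha eb eK.
exists S.
have g1 : (fun n => phi^h n * Complex (Xi f alpha n) 0) =
    (fun n => Complex (b n) 0 * inner (fun t => K (t + n%:~R * alpha)) K).
  by apply/funext => n; rewrite Xi_inner0 (expansion_fourier n eb).
rewrite g1; split; split.
- exact: (expansion_abs_summable alpha eb eK).
- exact: (conj h1 h2).
- exact: (expansion_abs_summable alpha eK eb).
- exact: (conj h3 h4).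
Qed.

End Diffraction.

(** * Averages along rotation orbits *)

Section BirkhoffAverages.
Variable R : realType.
Local Notation CC := (complex R).
Local Notation I01 := (@Rint01 R).
Local Notation U := (@unit_ico R).
Local Notation mu := (@leb R).
Local Notation LT := (caratheodory_type (R := R) (wlength (@idfun R))^*%mu).
Local Notation Re := (@complex.Re R).
Local Notation Im := (@complex.Im R).
Local Notation frac := (@Defs.frac R).
Implicit Types (beta x y : R) (f g h p q : R -> R).

Definition bsum beta g n y : R := \sum_(i < n) g (y + i%:R * beta).
(** The index is shifted by one so that the divisor is never zero. *)
Definition avg beta g y n : R := n.+1%:R^-1 * bsum beta g n.+1 y.

Lemma bsumS beta g n y : bsum beta g n.+1 y = g y + bsum beta g n (y + beta).
Proof.
rewrite /bsum big_ord_recl mul0r addr0; congr (_ + _); apply: eq_bigr => i _.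
by congr g; rewrite lift0 -natr1; ring.
Qed.

Lemma bmp_bsum beta g n : bmp g -> bmp (bsum beta g n).
Proof. by move=> bg; apply: bmp_sum => i; exact: bmp_shift. Qed.

Lemma avgB beta f g y n : avg beta (fun x => f x - g x) y n = avg beta f y n - avg beta g y n.
Proof. by rewrite /avg /bsum sumrB mulrBr. Qed.

Lemma le_avg beta f g y n : (forall x, f x <= g x) -> avg beta f y n <= avg beta g y n.
Proof. by move=> fg; rewrite ler_wpM2l// ler_sum. Qed.

Lemma norm_avg beta f y n : `|avg beta f y n| <= avg beta (fun x => `|f x|) y n.
Proof. by rewrite normrM ger0_norm// ler_wpM2l// ler_norm_sum. Qed.

Lemma bounded_div_cvg0 (s : nat -> R) (K : R) : (forall n, `|s n| <= K) ->
  (fun n => n.+1%:R^-1 * s n) @ \oo --> 0.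
Proof.
move=> sK; have c : (fun n => n.+1%:R^-1 * K) @ \oo --> (0 : R).
  by rewrite -[X in _ --> X](mul0r K); apply: cvgM; [exact: cvg_harmonic|exact: cvg_cst].
have cN : (fun n => - (n.+1%:R^-1 * K)) @ \oo --> (0 : R).
  by rewrite -[X in _ --> X]oppr0; exact: cvgN.
apply: (squeeze_cvgr _ cN c); near=> n.
rewrite -ler_norml normrM ger0_norm// ler_wpM2l//; exact: sK.
Unshelve. all: by end_near. Qed.

(** The denominators 1 - e(m beta) of the geometric sums do not vanish; this is all that the
    averages require of the angle. *)
Definition ergodic_angle beta := forall m : int, m != 0 -> echar m beta <> 1.

Lemma geometric_echar m beta n : (1 - echar m beta) * \sum_(i < n) echar m (i%:R * beta) = 1 - echar m (n%:R * beta).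
Proof.
elim: n => [|n IH]; first by rewrite big_ord0 mulr0 mul0r /echar mulr0 cexp0 subrr.
rewrite big_ord_recr /= mulrDr IH.
have -> : n.+1%:R * beta = n%:R * beta + beta by rewrite -natr1 mulrDl mul1r.
by rewrite echar_add; ring.
Qed.

(** By linearity one character suffices. Index 0 gives a constant; for any other index the geometric
    sum stays bounded, so division by n + 1 sends it to 0, which is the mean. *)
Lemma trig_avg beta (p : R -> CC) y : ergodic_angle beta -> trig p ->
  (fun n => n.+1%:R^-1 * Re (\sum_(i < n.+1) p (y + i%:R * beta))) @ \oo --> Re (cint01 p) /\
  (fun n => n.+1%:R^-1 * Im (\sum_(i < n.+1) p (y + i%:R * beta))) @ \oo --> Im (cint01 p).
Proof.
move=> eb; elim=> [z m|p1 p2 t1 [R1 I1] t2 [R2 I2]]; last first.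
  rewrite cintD; [|exact: trig_cbmp..]; rewrite cReD cImD; split.
    under eq_fun do rewrite big_split cReD mulrDr; exact: cvgD.
  under eq_fun do rewrite big_split cImD mulrDr; exact: cvgD.
rewrite cintZ; last exact: cbmp_echar.
rewrite cint_echar; case: (eqVneq m 0) => [->|m0].
  rewrite mulr1.
  have cR n : n.+1%:R^-1 * Re (\sum_(i < n.+1) z * echar 0 (y + i%:R * beta)) = Re z.
    have -> : Re (\sum_(i < n.+1) z * echar 0 (y + i%:R * beta)) = n.+1%:R * Re z.
      by rewrite cRe_sum; under eq_bigr do rewrite echar0 mulr1; rewrite sumr_const card_ord mulr_natl.
    by rewrite mulKf.
  have cI n : n.+1%:R^-1 * Im (\sum_(i < n.+1) z * echar 0 (y + i%:R * beta)) = Im z.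
    have -> : Im (\sum_(i < n.+1) z * echar 0 (y + i%:R * beta)) = n.+1%:R * Im z.
      by rewrite cIm_sum; under eq_bigr do rewrite echar0 mulr1; rewrite sumr_const card_ord mulr_natl.
    by rewrite mulKf.
  split; [under eq_fun do rewrite cR; exact: cvg_cst|under eq_fun do rewrite cI; exact: cvg_cst].
rewrite mulr0.
have w0 : 1 - echar m beta != 0.
  by rewrite subr_eq0 eq_sym; apply/eqP; exact: eb.
pose d := z * echar m y * (1 - echar m beta)^-1.
have sE n : \sum_(i < n) z * echar m (y + i%:R * beta) = d * (1 - echar m (n%:R * beta)).
  rewrite -geometric_echar /d mulrA mulfVK// mulr_sumr; apply: eq_bigr => i _.
  by rewrite echar_add mulrA.
have ab (u v c s : R) : `|c| <= 1 -> `|s| <= 1 -> `|u * (1 - c) - v * (- s)| <= 2 * (`|u| + `|v|) /\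
   `|u * (- s) + v * (1 - c)| <= 2 * (`|u| + `|v|).
  move=> hc hs.
  have c2 : `|1 - c| <= 2 by rewrite (le_trans (ler_normB _ _))// normr1; lra.
  have u1 := ler_wpM2l (normr_ge0 u) c2; have u2 := ler_wpM2l (normr_ge0 u) hs.
  have v1 := ler_wpM2l (normr_ge0 v) c2; have v2 := ler_wpM2l (normr_ge0 v) hs.
  have u0 := normr_ge0 u; have v0 := normr_ge0 v.
  split; [apply: le_trans (ler_normB _ _) _|apply: le_trans (ler_normD _ _) _];
   rewrite !normrM normrN; lra.
split; apply: (@bounded_div_cvg0 _ (2 * (`|Re d| + `|Im d|))) => n; rewrite sE;
  have [h1 h2] := echar_ReIm_le1 m (n.+1%:R * beta); have [a1 a2] := ab (Re d) (Im d) _ _ h1 h2.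
- by rewrite cReM cReD cImD cReN cImN /= sub0r.
- by rewrite cImM cReD cImD cReN cImN /= sub0r.
Qed.

Lemma rtrig_avg beta p y : ergodic_angle beta -> rtrig p -> avg beta p y @ \oo --> I01 p.
Proof.
move=> eb tp; have [h _] := trig_avg y eb tp; rewrite cint_real in h.
by move: h; under eq_fun do rewrite cRe_sum.
Qed.

(** The running maximum of the orbit sums; the value 0 at the start is the empty sum and keeps the
    maximum nonnegative. *)
Fixpoint bmax beta g N x : R :=
  if N is N'.+1 then Num.max (bmax beta g N' x) (bsum beta g N x) else 0.

Lemma bmax_ge0 beta g N x : 0 <= bmax beta g N x.
Proof. by elim: N => //= N IH; rewrite le_max IH. Qed.

Lemma bsum_le_bmax beta g n N x : (n <= N)%N -> bsum beta g n x <= bmax beta g N x.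
Proof.
elim: N => [|N IH]; first by rewrite leqn0 => /eqP ->; rewrite /bsum big_ord0.
rewrite leq_eqVlt => /predU1P[->|nN] /=; first by rewrite le_max lexx orbT.
by rewrite le_max IH.
Qed.

Lemma bmp_bmax beta g N : bmp g -> bmp (bmax beta g N).
Proof.
move=> bg; elim: N => [|N IH] /=; first exact: bmp_cst.
by apply: bmp_max => //; exact: bmp_bsum.
Qed.

(** A positive maximum is attained by a nonempty sum, and removing its first term [g x] leaves an
    orbit sum started at [x + beta]. *)
Lemma bmax_step beta g N x : 0 < bmax beta g N x ->
  bmax beta g N x <= g x + bmax beta g N (x + beta).
Proof.
suff H n : (n <= N)%N -> 0 < bmax beta g n x -> bmax beta g n x <= g x + bmax beta g N (x + beta).
  exact: H.
elim: n => [|n IH] nN /=; first by rewrite ltxx.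
have hb : bsum beta g n.+1 x <= g x + bmax beta g N (x + beta).
  by rewrite bsumS lerD2l bsum_le_bmax// ltnW.
rewrite lt_max ge_max hb andbT => /orP[h|h]; first by apply: IH => //; exact: ltnW.
have [h'|h'] := ltP 0 (bmax beta g n x); first by apply: IH => //; exact: ltnW.
by apply: le_trans h' _; apply: le_trans (ltW h) hb.
Qed.

Definition pos_ind h x : R := \1_([set t | 0 < h t]) x.

Lemma lmeas_pos h : bmp h -> lmeas [set t | 0 < h t].
Proof.
move=> [mh _ _]; have := mh measurableT `]0, +oo[%classic (measurable_itv _).
rewrite setTI (_ : h @^-1` _ = [set t | 0 < h t])//.
by apply/seteqP; split=> t /=; rewrite in_itv/= andbT.
Qed.

Lemma bmp_pos_ind h : bmp h -> bmp (pos_ind h).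
Proof.
move=> bh; have [_ _ ph] := bh; split.
- exact: (@measurable_indic _ LT R setT _ (lmeas_pos bh)).
- by exists 1 => x; rewrite /pos_ind indicE; case: (_ \in _); rewrite ?normr1 ?normr0.
- move=> x; rewrite /pos_ind !indicE; congr (nat_of_bool _)%:R.
  by apply/idP/idP; rewrite !inE /= ph.
Qed.

(* Garsia: where the running maximum M is positive, g >= M - M(. + beta), and elsewhere M = 0;
   both terms of the difference have the same mean. *)
Lemma maximal_ergodic beta g N : bmp g -> 0 <= I01 (fun x => pos_ind (bmax beta g N) x * g x).
Proof.
move=> bg; have bM := bmp_bmax beta N bg; have ba := bmp_pos_ind bM.
have bMs := bmp_shift beta bM.
rewrite -(subrr (I01 (bmax beta g N))) -{2}(I01_shift beta bM) -I01B//.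
apply: le_I01 => [||x _]; [exact: bmpB|exact: bmpM|].
have M1 := bmax_ge0 beta g N x; have M2 := bmax_ge0 beta g N (x + beta).
rewrite /pos_ind indicE; case: (boolP (_ \in _)) => [/set_mem/=/bmax_step h|h].
  by rewrite mulr1n mul1r; lra.
have {}h : bmax beta g N x <= 0 by rewrite leNgt; apply/negP => h'; move/negP: h; apply; exact: mem_set.
by rewrite mulr0n mul0r; lra.
Qed.

(** Garsia's inequality for g - lambda bounds lambda times the measure of each [A N] by the mean of
    [g] over it, hence by [I01 g] as g >= 0. The sets [A N] increase, so the bound passes to their
    union. *)
Lemma maximal_inequality beta g (lambda : R) : bmp g -> (forall x, 0 <= g x) -> 0 < lambda ->
  exists A : set R, [/\ lmeas A, (mu A <= (I01 g / lambda)%:E)%E &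
    forall x n, U x -> lambda < avg beta g x n -> A x].
Proof.
move=> bg g0 l0; pose h x := g x - lambda.
have bh : bmp h by apply: bmpB => //; exact: bmp_cst.
pose A N := U `&` [set x | 0 < bmax beta h N x].
have mA N : lmeas (A N) by apply: lmeasI; [exact: lmeas_unit|apply: lmeas_pos; exact: bmp_bmax].
have AN N : (mu (A N) <= (I01 g / lambda)%:E)%E.
  have ba := bmp_pos_ind (bmp_bmax beta N bh).
  have c1 := bmp_cst lambda.
  have H : lambda * I01 (pos_ind (bmax beta h N)) <= I01 g.
    have := maximal_ergodic beta N bh.
    rewrite (_ : (fun x => _) = fun x => pos_ind (bmax beta h N) x * g x - lambda * pos_ind (bmax beta h N) x).
      rewrite I01B ?I01Z ?subr_ge0//; [|exact: bmpM..].
      move/le_trans; apply; apply: le_I01 => //; [exact: bmpM|move=> x _].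
      rewrite /pos_ind indicE; case: (_ \in _); first by rewrite mulr1n mul1r.
      by rewrite mulr0n mul0r.
    by apply/funext => x; rewrite /h; ring.
  have AU : mu (A N) = (I01 (\1_(A N)))%:E.
    rewrite I01_set//; last exact: subIsetl.
    rewrite fineK// ge0_fin_numE; last exact: mu_ext_ge0.
    apply: (@le_lt_trans _ _ (mu U)); last by rewrite leb_unit ltry.
    by apply: le_outer_measure; exact: subIsetl.
  rewrite AU lee_fin ler_pdivlMr// mulrC.
  rewrite (@eq_I01 _ _ (pos_ind (bmax beta h N)))// => x Ux.
  rewrite /pos_ind !indicE; congr (nat_of_bool _)%:R.
  by apply/idP/idP; rewrite !inE /A /=; [case|].
exists (\bigcup_N A N); split; first exact: lmeas_bigcup.
- have nd : nondecreasing_seq A.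
    apply/nondecreasing_seqP => N; apply/subsetPset => x [Ux /= Ax]; split => //=.
    by rewrite lt_max Ax.
  have c := @nondecreasing_cvg_mu _ LT R mu A mA (lmeas_bigcup mA) nd.
  by apply: (cvge_to_le c); near=> N; exact: AN.
- move=> x n Ux; rewrite /avg mulrC ltr_pdivlMr// => H; exists n.+1 => //; split => //=.
  rewrite lt_max; apply/orP; right.
  by rewrite /bsum /h sumrB sumr_const card_ord subr_gt0 -mulr_natr.
Unshelve. all: by end_near. Qed.

(** Completeness: a set of outer measure zero satisfies the Carathéodory criterion. Exceptional sets
    thus need only an outer bound, and their measurability is never examined. *)
Lemma leb0_negligible (A : set R) : mu A = 0%E -> mu.-negligible A.
Proof.
move=> A0; exists A; split => //.
apply: le_caratheodory_measurable => X /=.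
apply: (@le_trans _ _ (mu A + mu (X `&` ~` A))%E).
  by apply: leeD => //; apply: le_outer_measure; exact: subIsetr.
by rewrite A0 add0e; apply: le_outer_measure; exact: subIsetl.
Qed.

Theorem birkhoff_ae beta h : ergodic_angle beta -> bmp h ->
  {ae mu, forall y, U y -> avg beta h y @ \oo --> I01 h}.
Proof.
move=> eb bh.
(* The factor 3 counts three errors of size 1/(k + 1): between the means of [h] and [p], between the
   mean and the averages of [p], and between the averages of [p] and [h]. *)
pose Z (k : nat) := U `&` [set y | ~ \forall n \near \oo, `|I01 h - avg beta h y n| <= 3 * k.+1%:R^-1].
have Z0 k : mu.-negligible (Z k).
  apply: leb0_negligible; apply/eqP; rewrite eq_le; apply/andP; split; last exact: mu_ext_ge0.
  apply/lee_addgt0Pr => e e0; rewrite add0e.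
  pose l : R := k.+1%:R^-1; have l0 : 0 < l by rewrite invr_gt0.
  (* The bound [l] controls the difference of the means; the bound [l * e] makes the exceptional set
     of the maximal inequality at level [l] of measure at most [e]. *)
  have d0 : 0 < Num.min l (l * e) by rewrite lt_min l0 mulr_gt0.
  have [p [tp hp]] := trig_approx1 bh d0.
  have bp := rtrig_bmp tp; have bD := bmpB bh bp; have bN := bmp_norm bD.
  move: hp; rewrite lt_min => /andP[hp1 hp2].
  have [A [mA Ae AP]] := @maximal_inequality beta (fun x => `|h x - p x|) l bN (fun x => normr_ge0 _) l0.
  apply: (@le_trans _ _ (mu A)); last first.
    by apply: le_trans Ae _; rewrite lee_fin ler_pdivrMr// mulrC ltW.
  apply: le_outer_measure => y [Uy nY]; apply: contrapT => nA; apply: nY.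
  have := rtrig_avg y eb tp => /cvgrPdist_le/(_ _ l0) cp; near=> n.
  have h1 : `|I01 h - I01 p| <= l.
    by rewrite -I01B// (le_trans (I01_norm bD))// ltW.
  have h2 : `|I01 p - avg beta p y n| <= l by near: n.
  have h3 : `|avg beta p y n - avg beta h y n| <= l.
    rewrite distrC -avgB (le_trans (norm_avg _ _ _ _))// leNgt; apply/negP => H.
    by apply: nA; exact: (AP y n).
  rewrite (_ : I01 h - _ = (I01 h - I01 p) + ((I01 p - avg beta p y n) + (avg beta p y n - avg beta h y n))); last by ring.
  rewrite (le_trans (ler_normD _ _))//; have := ler_normD (I01 p - avg beta p y n) (avg beta p y n - avg beta h y n).
  rewrite -/l; lra.
have [A [mA A0 ZA]] := @negligible_bigcup _ LT R mu Z Z0.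
exists A; split => // y /= /not_implyP[Uy nc]; apply: ZA.
apply: contrapT => nZ; apply: nc; apply/cvgrPdist_le => e e0.
have e3 : 0 < e / 3 by rewrite divr_gt0.
have [k kE] : exists k : nat, k.+1%:R^-1 < e / 3.
  by have [k _ /(_ k (leqnn k)) H] := near_infty_natSinv_lt (PosNum e3); exists k.
have Zk : \forall n \near \oo, `|I01 h - avg beta h y n| <= 3 * k.+1%:R^-1.
  by apply: contrapT => H; apply: nZ; exists k.
apply: filterS Zk => n H; apply: le_trans H _.
by rewrite mulrC -ler_pdivlMr// ltW.
Unshelve. all: by end_near. Qed.

End BirkhoffAverages.

(** * From orbit averages to the autocorrelation *)

Section Autocorrelation.
Variable R : realType.
Implicit Types (u v : nat -> R).

Lemma cvg_dist_le u v (L : R) : (forall n, `|L - u n| <= v n) -> v @ \oo --> 0 -> u @ \oo --> L.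
Proof.
move=> uv v0; apply/cvgrPdist_le => e e0.
move: v0 => /cvgrPdist_le/(_ _ e0); apply: filterS => n; rewrite sub0r normrN => h.
exact: le_trans (uv n) (le_trans (ler_norm _) h).
Qed.

Lemma sum_ltn_le (c K : nat) : \sum_(i < K) (i < c)%N%:R <= c%:R :> R.
Proof.
suff H : \sum_(i < K) (i < c)%N%:R <= (minn K c)%:R :> R.
  by apply: le_trans H _; rewrite ler_nat geq_minr.
elim: K => [|K IH]; first by rewrite big_ord0.
rewrite big_ord_recr /=; case: (ltnP K c) => Kc.
  have -> : (minn K.+1 c) = (minn K c).+1 by lia.
  by rewrite -natr1 lerD2r.
by rewrite mulr0n addr0 (le_trans IH)// ler_nat; lia.
Qed.

Lemma ssum_halves (V : zmodType) (G : int -> V) n :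
  ssum G n = \sum_(i < n.+1) G i%:Z + \sum_(i < n.+1) G (- i%:Z) - G 0.
Proof.
elim: n => [|n IH]; first by rewrite ssum0 !big_ord_recl !big_ord0 !addr0; exact: (esym (addrK (G 0) (G 0))).
rewrite ssumS IH [in RHS]big_ord_recr [X in _ = _ + X - _]big_ord_recr /=.
rewrite [in RHS]addrACA -!addrA; congr (_ + (_ + _)).
by rewrite addrC addrA.
Qed.

(** The sums differ only where a - z leaves the window, that is for at most |z| indices at one end.
    Both ends are charged so as not to split on the sign of [z]; [rev_ord] counts from the far
    end. *)
Lemma restr_corr_error (w : int -> R) (M : R) (n : nat) (z : int) : (forall a, `|w a| <= M) ->
  `|ssum (fun a => restr w n a * restr w n (a - z)) n - ssum (fun a => w a * w (a - z)) n|
    <= 2 * (absz z)%:R * M ^+ 2.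
Proof.
move=> wM; have M0 : 0 <= M by exact: le_trans (wM 0).
rewrite -ssumB /ssum (le_trans (ler_norm_sum _ _ _))//.
apply: (@le_trans _ _ (\sum_(i < (2 * n + 1)%N) ((i < absz z)%N%:R + (rev_ord i < absz z)%N%:R) * M ^+ 2)).
  apply: ler_sum => i _; have i2 := ltn_ord i.
  have -> : restr w n (i%:Z - n%:Z) = w (i%:Z - n%:Z) by rewrite /restr ifT//; lia.
  rewrite /restr; case: ifPn => h; first by rewrite subrr normr0 mulr_ge0// sqr_ge0.
  rewrite mulr0 sub0r normrN normrM expr2.
  apply: (@le_trans _ _ (1 * (M * M))); first by rewrite mul1r ler_pM.
  rewrite ler_wpM2r ?mulr_ge0//.
  have : ((i < absz z) || (rev_ord i < absz z))%N by rewrite /=; lia.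
  by case/orP => ->; rewrite ?lerDl ?lerDr.
rewrite -mulr_suml ler_wpM2r ?sqr_ge0// big_split /= mulr_natl mulr2n lerD//; first exact: sum_ltn_le.
rewrite (reindex_inj rev_ord_inj) /=.
under eq_bigr do rewrite -[X in (X < _)%N]/(nat_of_ord (rev_ord (rev_ord _))) rev_ordK.
exact: sum_ltn_le.
Qed.

Lemma autoc_cvg (f : R -> R) (alpha y L M : R) (z : int) :
  let F x := f (Defs.frac x) in let g x := F x * F (x - z%:~R * alpha) in
  (forall x, `|F x| <= M) -> avg alpha g y @ \oo --> L -> avg (- alpha) g y @ \oo --> L ->
  autoc_approx (mu_y f alpha y) ^~ z @ \oo --> L.
Proof.
move=> F g FM A B; pose w := mu_y f alpha y.
have wM a : `|w a| <= M by exact: FM.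
pose G a := w a * w (a - z).
have G1 (a : int) : G a = g (y + a%:~R * alpha).
  by rewrite /G /w /mu_y /Tpow /g /F rmorphB /= mulrBl addrA.
(* The bounded errors: the truncation, and the term at 0, which occurs in both one-sided orbits. As
   2n + 1 = 2(n + 1) - 1, the latter leaves exactly -(L - g y). *)
pose K := 2 * (absz z)%:R * M ^+ 2 + `|L - g y|.
apply: (@cvg_dist_le _ (fun n => n.+1%:R^-1 * K + (`|L - avg alpha g y n| + `|L - avg (- alpha) g y n|))); last first.
  rewrite [X in _ --> X](_ : _ = 0 * K + (`|L - L| + `|L - L|)); last by rewrite subrr normr0 mul0r !addr0.
  apply: cvgD; first by apply: cvgM; [exact: cvg_harmonic|exact: cvg_cst].
  by apply: cvgD; apply: cvg_norm; apply: cvgB => //; exact: cvg_cst.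
move=> n; pose T := ssum (fun a => restr w n a * restr w n (a - z)) n.
have n0 : 0 < n.+1%:R :> R by [].
have m0 : 0 < (2 * n + 1)%:R :> R by rewrite ltr0n addn1.
have nm : n.+1%:R <= (2 * n + 1)%:R :> R by rewrite ler_nat; lia.
have GE : ssum G n = n.+1%:R * avg alpha g y n + n.+1%:R * avg (- alpha) g y n - g y.
  rewrite ssum_halves /avg !mulVKf ?gt_eqF// /bsum G1 mul0r addr0; congr (_ + _ - _).
    by apply: eq_bigr => i _; rewrite G1.
  by apply: eq_bigr => i _; rewrite G1 mulrNz mulNr mulrN.
have TG : `|T - ssum G n| <= 2 * (absz z)%:R * M ^+ 2 by exact: restr_corr_error.
rewrite (_ : autoc_approx _ _ _ = (2 * n + 1)%:R^-1 * T)//.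
set a := avg alpha g y n in GE *; set b := avg (- alpha) g y n in GE *.
have E1 : L - (2 * n + 1)%:R^-1 * T = (2 * n + 1)%:R^-1 *
   ((L - g y) * -1 + (ssum G n - T) + (n.+1%:R * (L - a) + n.+1%:R * (L - b))).
  have e1 : L = (2 * n + 1)%:R^-1 * ((2 * n + 1)%:R * L) by rewrite mulKf// gt_eqF.
  rewrite {1}e1 -mulrBr; congr (_ * _); rewrite GE -natr1 natrD natrM; ring.
rewrite E1 normrM ger0_norm ?invr_ge0// [leLHS]mulrC ler_pdivrMr//.
have s1 : `|(L - g y) * -1 + (ssum G n - T) + (n.+1%:R * (L - a) + n.+1%:R * (L - b))|
   <= K + n.+1%:R * (`|L - a| + `|L - b|).
  rewrite (le_trans (ler_normD _ _))// lerD//.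
    by rewrite (le_trans (ler_normD _ _))// normrM normrN1 mulr1 addrC lerD// distrC.
  by rewrite (le_trans (ler_normD _ _))// !normrM (ger0_norm (ltW n0)) mulrDr.
have K0 : 0 <= K by rewrite addr_ge0// mulr_ge0 ?sqr_ge0// mulr_ge0.
apply: (le_trans s1); rewrite mulrDl lerD//.
  by rewrite mulrAC -[leLHS]mul1r ler_wpM2r// mulrC ler_pdivlMr// mul1r.
by rewrite mulrC ler_wpM2l// addr_ge0.
Qed.

End Autocorrelation.

(** * Averages at every starting point *)

Section UniformDistribution.
Variable R : realType.
Local Notation I01 := (@Rint01 R).
Local Notation U := (@unit_ico R).
Local Notation mu := (@leb R).
Local Notation frac := (@Defs.frac R).
Implicit Types (beta x y a : R) (f g h p q P : R -> R).

(** The majorant holds at every point, so it controls the error along any orbit, and being a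
    trigonometric polynomial it has convergent averages from every starting point. *)
Definition trig_dom h := bmp h /\ forall eps : R, 0 < eps -> exists p P,
  [/\ rtrig p, rtrig P, forall x, `|h x - p x| <= P x & I01 P < eps].

(** The averages of |h - p| are eventually at most I01 P + e / 4 <= e / 2; the means and the
    averages of [p] contribute [e / 4] each. *)
Lemma trig_dom_avg beta h y : ergodic_angle beta -> trig_dom h -> avg beta h y @ \oo --> I01 h.
Proof.
move=> eb [bh H]; apply/cvgrPdist_le => e e0.
have e4 : 0 < e / 4 by rewrite divr_gt0.
have [p [P [tp tP hpP IP]]] := H _ e4.
have bp := rtrig_bmp tp; have bP := rtrig_bmp tP; have bD := bmpB bh bp.
have h1 : `|I01 h - I01 p| <= e / 4.
  rewrite -I01B// (le_trans (I01_norm bD))//; apply: le_trans (ltW IP).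
  by apply: le_I01 => //; exact: bmp_norm.
have /cvgrPdist_le/(_ _ e4) cp := rtrig_avg y eb tp.
have /cvgrPdist_le/(_ _ e4) cP := rtrig_avg y eb tP.
near=> n.
have h2 : `|I01 p - avg beta p y n| <= e / 4 by near: n.
have /ler_normlP[h3 h3'] : `|I01 P - avg beta P y n| <= e / 4 by near: n.
have h4 : `|avg beta p y n - avg beta h y n| <= avg beta P y n.
  rewrite distrC -avgB (le_trans (norm_avg _ _ _ _))//; exact: le_avg.
rewrite (_ : I01 h - _ = (I01 h - I01 p) + ((I01 p - avg beta p y n) + (avg beta p y n - avg beta h y n))); last by ring.
rewrite (le_trans (ler_normD _ _))//; have := ler_normD (I01 p - avg beta p y n) (avg beta p y n - avg beta h y n).
lra.
Unshelve. all: by end_near. Qed.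

Lemma trig_dom_rtrig p : rtrig p -> trig_dom p.
Proof.
move=> tp; split; first exact: rtrig_bmp.
move=> eps e0; exists p, (fun=> 0); split=> //; first exact: rtrig_cst.
  by move=> x; rewrite subrr normr0.
by rewrite I01_cst.
Qed.

Lemma trig_domD f g : trig_dom f -> trig_dom g -> trig_dom (fun x => f x + g x).
Proof.
move=> [bf af] [bg ag]; split; first exact: bmpD.
move=> eps e0; have e2 : 0 < eps / 2 by rewrite divr_gt0.
have [p [P [tp tP fp IP]]] := af _ e2; have [q [Q [tq tQ gq IQ]]] := ag _ e2.
exists (fun x => p x + q x), (fun x => P x + Q x); split; [exact: rtrigD|exact: rtrigD| |].
  by move=> x; rewrite opprD addrACA (le_trans (ler_normD _ _))// lerD.
by rewrite I01D; [lra|exact: rtrig_bmp..].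
Qed.

Lemma trig_domM f g : trig_dom f -> trig_dom g -> trig_dom (fun x => f x * g x).
Proof.
move=> [bf af] [bg ag]; split; first exact: bmpM.
move=> eps e0; have [_ [M fM] _] := bf.
have M0 : 0 <= M by exact: le_trans (fM 0).
have e1 : 0 < eps / 2 / (M + 1) by rewrite !divr_gt0// ltr_wpDl.
have [q [Q [tq tQ gq IQ]]] := ag _ e1; have bq := rtrig_bmp tq.
have [_ [N qN] _] := bq.
have N0 : 0 <= N by exact: le_trans (qN 0).
have e2 : 0 < eps / 2 / (N + 1) by rewrite !divr_gt0// ltr_wpDl.
have [p [P [tp tP fp IP]]] := af _ e2.
exists (fun x => p x * q x), (fun x => (M + 1) * Q x + (N + 1) * P x); split; first exact: rtrigM.
- by apply: rtrigD; apply: rtrigM => //; exact: rtrig_cst.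
- move=> x; rewrite (_ : _ - _ = f x * (g x - q x) + q x * (f x - p x)); last by ring.
  rewrite (le_trans (ler_normD _ _))// !normrM lerD// ler_pM// ler_wpDr//.
- have bP := rtrig_bmp tP; have bQ := rtrig_bmp tQ.
  rewrite I01D; [|by apply: bmpM => //; exact: bmp_cst..].
  rewrite !I01Z// [ltRHS]splitr ltrD// mulrC -ltr_pdivlMr// ltr_wpDl//.
Qed.

Lemma trig_dom_shift (c : R) f : trig_dom f -> trig_dom (fun x => f (x + c)).
Proof.
move=> [bf af]; split; first exact: bmp_shift.
move=> eps /af[p [P [tp tP fp IP]]].
exists (fun x => p (x + c)), (fun x => P (x + c)); split; [exact: rtrig_shift|exact: rtrig_shift| |].
  by move=> x; exact: fp.
by rewrite I01_shift//; exact: rtrig_bmp.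
Qed.

Lemma trig_domZ (c : R) f : trig_dom f -> trig_dom (fun x => c * f x).
Proof. by move=> tf; apply: trig_domM => //; apply: trig_dom_rtrig; exact: rtrig_cst. Qed.

Lemma trig_dom_sum (N : nat) (F : 'I_N -> R -> R) : (forall k, trig_dom (F k)) ->
  trig_dom (fun x => \sum_(k < N) F k x).
Proof.
elim: N F => [|N IH] F aF.
  by under eq_fun do rewrite big_ord0; apply: trig_dom_rtrig; exact: rtrig_cst.
by under eq_fun do rewrite big_ord_recr; apply: trig_domD => //; exact: IH.
Qed.

(** The error bound [D] need not be a trigonometric polynomial: it lies below q + Q for its own
    approximant [q] and majorant [Q], and I01 q <= I01 D + I01 Q. Four terms of size [eps / 4]
    result. *)
Lemma trig_dom_closed h : bmp h -> (forall eps : R, 0 < eps -> exists g D,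
    [/\ trig_dom g, trig_dom D, forall x, `|h x - g x| <= D x & I01 D < eps]) -> trig_dom h.
Proof.
move=> bh H; split=> // eps e0; have e4 : 0 < eps / 4 by rewrite divr_gt0.
have [g [D [[bg ag] [bD aD] hD ID]]] := H _ e4.
have [p [P [tp tP gp IP]]] := ag _ e4; have [q [Q [tq tQ Dq IQ]]] := aD _ e4.
have bP := rtrig_bmp tP; have bQ := rtrig_bmp tQ; have bq := rtrig_bmp tq.
exists p, (fun x => P x + (q x + Q x)); split=> //; first by apply: rtrigD => //; exact: rtrigD.
  move=> x; rewrite (_ : h x - p x = (g x - p x) + (h x - g x)); last by ring.
  rewrite (le_trans (ler_normD _ _))// lerD//; apply: le_trans (hD x) _.
  by have /ler_normlP[_ h2] := Dq x; lra.
rewrite I01D//; last exact: bmpD.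
rewrite I01D//.
have : I01 q <= I01 D + I01 Q.
  rewrite -I01D//; apply: le_I01 => //; first exact: bmpD.
  by move=> x _; have /ler_normlP[h1 _] := Dq x; lra.
lra.
Qed.

Lemma vstep_neq0 a x : 0 <= a <= 1 -> U x -> x <> 0 -> x <> a -> vstep a x != 0.
Proof.
move=> /andP[a0 a1]; rewrite /unit_ico/= in_itv/= => /andP[x0 x1] /eqP nx0 /eqP nxa.
have {}x0 : 0 < x by rewrite lt_neqAle eq_sym nx0.
case: (ltgtP x a) nxa => [xa|ax|//] _; first by rewrite lt_eqF// vstep_lt0.
by rewrite gt_eqF// vstep_gt0.
Qed.

Lemma vstep_sign a x : 0 <= a <= 1 -> U x ->
  (vstep a x < 0 -> x < a) /\ (0 < vstep a x -> a <= x).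
Proof.
move=> /andP[a0 a1]; rewrite /unit_ico/= in_itv/= => /andP[x0 x1].
split; rewrite ltNge => /negP nv.
- rewrite ltNge; apply/negP; rewrite le_eqVlt => /predU1P[xa|ax]; apply: nv.
    by rewrite vstepE xa subrr mulr0 sin0 mulr0.
  by rewrite ltW// vstep_gt0.
- rewrite leNgt; apply/negP => xa; apply: nv.
  move: x0; rewrite le_eqVlt => /predU1P[<-|x0]; first by rewrite vstepE mulr0 sin0 mul0r.
  by rewrite ltW// vstep_lt0.
Qed.

Lemma expr_small (t e : R) : 0 <= t < 1 -> 0 < e -> \forall n \near \oo, t ^+ n <= e.
Proof.
move=> /andP[t0 t1] e0.
have /cvg_expr/cvgrPdist_le/(_ _ e0) : `|t| < 1 by rewrite ger0_norm.
apply: filterS => n; rewrite sub0r normrN; exact: le_trans (ler_norm _).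
Qed.

(* Near the endpoints of the arc the error is at most 1, and there [v ^+ 2] is small:
   hence the majorant [2 * (1 - v ^+ 2) ^+ k]. *)
Lemma trig_dom_step a : 0 <= a <= 1 -> trig_dom (fun x => \1_`[0, a[%classic (frac x)).
Proof.
move=> a01; have tI := trig_approx2_step a01; split; first by case: tI.
move=> eps e0; pose v := vstep a.
have v2 x : 0 <= v x ^+ 2 <= 1.
  by rewrite sqr_ge0 -[v x ^+ 2]real_normK ?num_real// exprn_ile1//; exact: vstep_le1.
have tW k : rtrig (fun x => 2 * (1 - v x ^+ 2) ^+ k).
  apply: rtrigM; first exact: rtrig_cst.
  by apply: rtrigX; apply: rtrigB; [exact: rtrig_cst|apply: rtrigX; exact: rtrig_vstep].
have : (fun k => I01 (fun x => 2 * (1 - v x ^+ 2) ^+ k)) @ \oo --> I01 (fun=> 0).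
  apply: (@I01_cvg _ _ _ 2) => [k||k x|]; [exact: rtrig_bmp|exact: bmp_cst| |].
    have /andP[h1 h2] := v2 x.
    have w0 : 0 <= 1 - v x ^+ 2 by lra.
    by rewrite ger0_norm ?mulr_ge0 ?exprn_ge0// ler_piMr// exprn_ile1//; lra.
  apply: ae_imp (ae_and (ae_neq (R:=R) 0) (ae_neq a)) => x [x0 xa] Ux.
  rewrite -[X in _ --> X](mulr0 2); apply: cvgM; first exact: cvg_cst.
  apply: cvg_expr; have /andP[h1 h2] := v2 x.
  have : 0 < v x ^+ 2 by rewrite lt_neqAle h1 andbT eq_sym sqrf_eq0 vstep_neq0.
  by rewrite ger0_norm; lra.
have e2 : 0 < eps / 2 by rewrite divr_gt0.
rewrite I01_cst => /cvgrPdist_lt/(_ _ e2)[k0 _ /(_ k0.+1 (leqnSn k0))].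
set k := k0.+1; rewrite sub0r normrN => /(le_lt_trans (ler_norm _)) Ik.
(* Where v^2 <= eta, Bernoulli's inequality gives (1 - v^2)^k >= 1 - k eta = 1/2, so the majorant is
   at least 1. *)
pose eta : R := (2 * k%:R)^-1.
have k1 : 1 <= k%:R :> R by rewrite ler1n.
have eta0 : 0 < eta by rewrite invr_gt0 mulr_gt0// ltr0n.
have eta1 : eta < 1 by rewrite invf_lt1; lra.
have e4 : 0 < eps / 4 by rewrite divr_gt0.
have [n n1 n2] : exists2 n, (1 - eta) ^+ n <= eps / 4 & (1 + eta)^-1 ^+ n <= eps / 4.
  near \oo => n; exists n; near: n; apply: expr_small => //; first by lra.
  by rewrite invr_ge0 invf_lt1; lra.
exists (smooth_step a n), (fun x => eps / 4 + 2 * (1 - v x ^+ 2) ^+ k); split.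
- exact: rtrig_smooth_step.
- by apply: rtrigD => //; exact: rtrig_cst.
- move=> x.
  have [_ _ ps] := rtrig_bmp (rtrig_smooth_step a n).
  have [_ _ pv] := rtrig_bmp (rtrig_vstep a).
  rewrite /v -(per_frac x ps) -(per_frac x pv).
  move: (frac x) (frac_ico x) => {}x Ux.
  have /andP[s0 s1] := smooth_step_01 a n x.
  have /andP[h1 h2] := v2 x; rewrite -/(v x).
  have w0 : 0 <= 1 - v x ^+ 2 by lra.
  have w1 := exprn_ge0 k w0.
  have /ler_normlP[v3 v4] := vstep_le1 a x; rewrite -/(v x) in v3 v4.
  have [vs1 vs2] := vstep_sign a01 Ux.
  have x0 : 0 <= x by move: Ux; rewrite /unit_ico/= in_itv/= => /andP[].
  have i01 : 0 <= (\1_`[0, a[%classic x : R) <= 1.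
    by rewrite indicE; case: (_ \in _); rewrite /= ?lexx ?ler01.
  have [small|big] := leP (v x ^+ 2) eta.
    have : 1 / 2 <= (1 - v x ^+ 2) ^+ k.
      have B : 1 + k%:R * (- v x ^+ 2) <= (1 - v x ^+ 2) ^+ k by apply: bernoulli_ge; lra.
      apply: le_trans B; rewrite mulrN.
      have : k%:R * v x ^+ 2 <= k%:R * eta by rewrite ler_wpM2l.
      have -> : k%:R * eta = 1 / 2 by rewrite /eta; field; rewrite gt_eqF//; lra.
      lra.
    move: i01 => /andP[i0 i1]; rewrite ler_norml; lra.
  (* Since |v| <= 1, v^2 > eta forces |v| > eta; the choice of [n] then makes the smooth step
     accurate to [eps / 4]. *)
  have big' : eta < `|v x|.
    apply: lt_le_trans big _; rewrite -[v x ^+ 2]real_normK ?num_real// expr2.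
    by rewrite ler_piMr//; exact: vstep_le1.
  suff : `|\1_`[0, a[%classic x - smooth_step a n x| <= eps / 4 by move=> /le_trans; apply; lra.
  rewrite indicE; case: (ltrgt0P (v x)) big' => [vp|vn|_] big'; last by move: eta0; lra.
  + rewrite memNset /=; last by rewrite in_itv/= => /andP[_]; have := vs2 vp; lra.
    rewrite mulr0n sub0r normrN ger0_norm//; apply: le_trans n2.
    rewrite exprVn -[leRHS]mul1r ler_pdivlMr; last by apply: exprn_gt0; lra.
    apply: le_trans (smooth_step_hi a n x); rewrite ler_wpM2l// lerXn2r ?nnegrE; rewrite -/(v x); lra.
  + rewrite mem_set /=; last by rewrite in_itv/= x0 vs1.
    rewrite mulr1n ger0_norm ?subr_ge0//; apply: le_trans (smooth_step_lo a n x) _.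
    by apply: le_trans n1; rewrite lerXn2r ?nnegrE; rewrite -/(v x); lra.
- rewrite I01D; [|exact: bmp_cst|exact: rtrig_bmp].
  by rewrite I01_cst; lra.
Unshelve. all: by end_near. Qed.

End UniformDistribution.

(** * Riemann integrable functions *)

Section RiemannIntegrable.
Variable R : realType.
Local Notation I01 := (@Rint01 R).
Local Notation U := (@unit_ico R).
Local Notation mu := (@leb R).
Local Notation frac := (@Defs.frac R).
Implicit Types (x y a : R) (f g h : R -> R).

Definition grid (n : nat) (i : nat) : R := i%:R / n.+1%:R.
(** A difference of two arcs starting at 0, so that [trig_dom_step] applies directly. *)
Definition cell (n i : nat) x : R :=
  \1_`[0, grid n i.+1[%classic (frac x) + (-1) * \1_`[0, grid n i[%classic (frac x).

Lemma grid_01 n i : (i <= n.+1)%N -> 0 <= grid n i <= 1.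
Proof.
by move=> i_n; rewrite divr_ge0//= ler_pdivrMr// mul1r ler_nat.
Qed.

Lemma grid_lt n i : grid n i < grid n i.+1.
Proof. by rewrite ltr_pM2r ?invr_gt0// ltr_nat. Qed.

Lemma gridS n i : grid n i.+1 - grid n i = n.+1%:R^-1.
Proof. by rewrite /grid -mulrBl -natr1 addrAC subrr add0r mul1r. Qed.

Lemma trig_dom_cell n i : (i < n.+1)%N -> trig_dom (cell n i).
Proof.
move=> i_n; apply: trig_domD; first by apply: trig_dom_step; exact: grid_01.
by apply: trig_domZ; apply: trig_dom_step; apply: grid_01; exact: ltnW.
Qed.

Lemma cellE n i x : (i < n.+1)%N -> U x -> cell n i x = (grid n i <= x < grid n i.+1)%R%:R.
Proof.
move=> i_n Ux; rewrite /cell frac_id//; move: Ux; rewrite /unit_ico/= in_itv/= => /andP[x0 x1].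
have E a : \1_`[0, a[%classic x = (x < a)%R%:R :> R.
  rewrite indicE; congr (nat_of_bool _)%:R.
  by apply/idP/idP; rewrite inE /= in_itv/= x0.
rewrite !E; have g := grid_lt n i; case: (ltP x (grid n i)) => h.
  by rewrite (lt_trans h g) /= mulr1 subrr.
by rewrite /= mulr0 addr0.
Qed.

Lemma I01_step a : 0 <= a <= 1 -> I01 (fun x => \1_`[0, a[%classic (frac x)) = a.
Proof.
move=> /andP[a0 a1]; have mA : lmeas `[0, a[%classic by exact: (lmeas_itv `[0, a[%R).
have AU : `[0, a[%classic `<=` U.
  by move=> x; rewrite /unit_ico/= !in_itv/= => /andP[-> xa]; exact: lt_le_trans xa a1.
rewrite (I01_frac (\1_`[0, a[%classic)) (I01_set mA AU).
rewrite leb_borel lebesgue_measure_itv/= lte_fin.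
by case: ltP => [_|h] /=; [rewrite subr0|apply/eqP; rewrite eq_le a0 h].
Qed.

Lemma I01_cell n i : (i < n.+1)%N -> I01 (cell n i) = n.+1%:R^-1.
Proof.
move=> i_n; have h1 := grid_01 i_n; have h0 := grid_01 (ltnW i_n).
have [b1 _] := trig_dom_step h1; have [b0 _] := trig_dom_step h0.
rewrite I01D//; last by apply: bmpM => //; exact: bmp_cst.
by rewrite I01Z// !I01_step// mulN1r gridS.
Qed.

Lemma sum_cell (F : nat -> R) n x : U x -> exists2 i, (i < n.+1)%N &
  grid n i <= x < grid n i.+1 /\ \sum_(j < n.+1) F j * cell n j x = F i.
Proof.
move=> Ux; have := Ux; rewrite /unit_ico/= in_itv/= => /andP[x0 x1].
have y0 : 0 <= x * n.+1%:R by rewrite mulr_ge0.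
pose i := Num.trunc (x * n.+1%:R).
have /andP[ti1 ti2] : i%:R <= x * n.+1%:R < i.+1%:R by exact: Num.Theory.truncn_itv.
have i_n : (i < n.+1)%N.
  by rewrite -(ltr_nat R) (le_lt_trans ti1)// -[ltRHS]mul1r ltr_pM2r.
have gi : grid n i <= x < grid n i.+1 by rewrite ler_pdivrMr// ltr_pdivlMr// ti1.
exists i => //; split=> //.
rewrite (bigD1 (Ordinal i_n))//= cellE// gi mulr1 big1 ?addr0// => j /eqP ji.
rewrite cellE//; case: (boolP (_ && _)) => [/andP[j1 j2]|_]; last by rewrite mulr0.
case: ji; apply: val_inj => /=.
have mono k l : grid n k < grid n l -> (k < l)%N by rewrite ltr_pM2r ?invr_gt0// ltr_nat.
case/andP: gi => i1 i2.
have h1 := mono _ _ (le_lt_trans j1 i2); have h2 := mono _ _ (le_lt_trans i1 j2); lia.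
Qed.

(** Riemann sums evaluate [f] at tags, and a supremum over a cell need not be attained. *)
Lemma near_sup (A : set R) f (M e : R) : 0 < e -> A !=set0 -> (forall x, A x -> f x <= M) ->
  exists2 t, A t & forall x, A x -> f x <= f t + e.
Proof.
move=> e0 [a Aa] fM.
have hs : has_sup (f @` A).
  by split; [exists (f a), a|exists M => _ [x Ax <-]; exact: fM].
have [_ [t At <-] ht] := sup_adherent e0 hs.
exists t => // x Ax; have : f x <= sup (f @` A) by apply: ub_le_sup; [case: hs|exists x].
lra.
Qed.

(** On each cell of one fine grid, [f] nearly reaches its supremum at the tag [t] and its infimum at
    [s]. Both tagged sums lie within [e] of the Riemann integral, so the step function [D]
    dominating the error has mean below 4 e < eps. *)
Lemma trig_dom_riemann f (M : R) : (forall x, U x -> `|f x| <= M) ->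
  bmp (fun x => f (frac x)) -> riemann_integrable f 0 1 -> trig_dom (fun x => f (frac x)).
Proof.
move=> fM bF [I RI]; apply: trig_dom_closed => // eps eps0.
pose e := eps / 5; have e0 : 0 < e by rewrite divr_gt0.
have [d d0 Hd] := RI e e0.
have [n nd] : exists n : nat, n.+1%:R^-1 < d.
  by have [k _ /(_ k (leqnn k)) H] := near_infty_natSinv_lt (PosNum d0); exists k.
pose C i := [set x : R | grid n i <= x < grid n i.+1].
have CU i : (i < n.+1)%N -> C i `<=` U.
  move=> i_n x /= /andP[x0 x1]; rewrite /unit_ico/= in_itv/=.
  have /andP[h0 _] := grid_01 (ltnW i_n); have /andP[_ h1] := grid_01 i_n.
  by rewrite (le_trans h0 x0) (lt_le_trans x1 h1).
have C0 i : C i !=set0 by exists (grid n i); rewrite /C/= lexx grid_lt.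
have tagsP (g : R -> R) : (forall x, U x -> `|g x| <= M) ->
    exists t : nat -> R, forall i, (i < n.+1)%N -> C i (t i) /\ forall x, C i x -> g x <= g (t i) + e.
  move=> gM; have H i : exists t, (i < n.+1)%N -> C i t /\ forall x, C i x -> g x <= g t + e.
    have [i_n|i_n] := ltnP i n.+1; last by exists 0.
    have [|t Ct tP] := @near_sup (C i) g M e e0 (C0 i); last by exists t.
    by move=> x /(CU _ i_n)/gM; apply: le_trans; exact: ler_norm.
  by have [t tP] := choice H; exists t.
have [t tP] := tagsP f fM.
have [s sP] : exists t : nat -> R, forall i, (i < n.+1)%N -> C i (t i) /\ forall x, C i x -> - f x <= - f (t i) + e.
  by apply: (tagsP (fun x => - f x)) => x Ux; rewrite normrN fM.
have tagsum (r : nat -> R) : (forall i, (i < n.+1)%N -> C i (r i)) ->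
    `|\sum_(i < n.+1) f (r i) * n.+1%:R^-1 - I| < e.
  move=> rC; have := Hd n.+1 (grid n) r; rewrite /grid mul0r divff// => /(_ erefl erefl).
  under eq_bigr do rewrite -!/(grid n _) gridS.
  apply=> i i_n; rewrite -!/(grid n _) gridS; split=> //; first exact: grid_lt.
  by have /andP[-> /ltW ->] := rC i i_n.
have /ltr_normlP[t1 t2] := tagsum t (fun i i_n => (tP i i_n).1).
have /ltr_normlP[s1 s2] := tagsum s (fun i i_n => (sP i i_n).1).
pose g x := \sum_(i < n.+1) f (t i) * cell n i x.
(* One [e] pays for the near-infimum at [s]; the other covers the case where f at [t] is slightly
   below f at [s]. *)
pose D x := \sum_(i < n.+1) (f (t i) - f (s i) + 2 * e) * cell n i x.
have tg (G : nat -> R) : trig_dom (fun x => \sum_(i < n.+1) G i * cell n i x).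
  by apply: trig_dom_sum => i; apply: trig_domZ; exact: trig_dom_cell.
exists g, D; split; [exact: (tg (fun i => f (t i)))|exact: (tg (fun i => f (t i) - f (s i) + 2 * e))| |].
- move=> x; have [[_ _ pg] _] := tg (fun i => f (t i)).
  have [[_ _ pD] _] := tg (fun i => f (t i) - f (s i) + 2 * e).
  rewrite -[g x](per_frac x pg) -[D x](per_frac x pD).
  move: (frac x) (frac_ico x) => {}x Ux; rewrite -/(g x) -/(D x).
  have [i i_n [ix gx]] := sum_cell (fun i => f (t i)) n Ux.
  have [j j_n [jx Dx]] := sum_cell (fun i => f (t i) - f (s i) + 2 * e) n Ux.
  have mono k l : grid n k < grid n l -> (k < l)%N by rewrite ltr_pM2r ?invr_gt0// ltr_nat.
  have ij : i = j.
    case/andP: ix => i1 i2; case/andP: jx => j1 j2.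
    apply/eqP; rewrite eqn_leq -ltnS (mono _ _ (le_lt_trans i1 j2)) /=.
    by rewrite -ltnS (mono _ _ (le_lt_trans j1 i2)).
  subst j; rewrite /g /D gx Dx.
  have [Ct tm] := tP i i_n; have [Cs sm] := sP i i_n.
  have := tm x ix; have := sm x ix; have := tm _ Cs => *.
  by rewrite ler_norml; apply/andP; split; lra.
- have bc i : (i < n.+1)%N -> bmp (cell n i) by move=> /(@trig_dom_cell n)[].
  rewrite I01_sum; last by move=> i; apply: bmpM; [exact: bmp_cst|exact: bc].
  rewrite (eq_bigr (fun i : 'I_n.+1 => (f (t i) - f (s i) + 2 * e) * n.+1%:R^-1)); last first.
    by move=> i _; rewrite (I01Z _ (bc i (ltn_ord i))) I01_cell.
  rewrite -mulr_suml big_split sumrB /= sumr_const card_ord -mulr_natr.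
  move: t1 t2 s1 s2; rewrite -!mulr_suml.
  set T := \sum_(i < _) f (t _); set S := \sum_(i < _) f (s _) => t1 t2 s1 s2.
  rewrite (_ : _ * _ = T * n.+1%:R^-1 - S * n.+1%:R^-1 + 2 * e * (n.+1%:R * n.+1%:R^-1)); last by ring.
  rewrite divff// mulr1; have : eps = 5 * e by rewrite /e mulrC divfK.
  by move: (T / _) (S / _) t1 t2 s1 s2  e0 {Hd tagsP tP sP D tg} => u w; move: (e) => r; lra.
Qed.

End RiemannIntegrable.

Section Conclusion.
Variable R : realType.
Local Notation mu := (@leb R).

Lemma ae_forall_int (P : int -> R -> Prop) : (forall z, {ae mu, forall y, P z y}) ->
  {ae mu, forall y, forall z, P z y}.
Proof.
move=> H.
have N0 (k : nat) : mu.-negligible (if unpickle k is Some z then [set y | ~ P z y] else set0).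
  case: (unpickle k) => [z|]; first exact: H.
  by exists set0; split => //; exact: (@measurable0 _ (caratheodory_type (R := R) (wlength (@idfun R))^*%mu)).
have [A [mA A0 sA]] := negligible_bigcup N0.
exists A; split => // y /= /existsNP[z nP]; apply: sA.
by exists (pickle z); [|rewrite pickleK].
Qed.

Lemma ergodic_angle_irrational (alpha : R) : (forall q : rat, alpha != ratr q) ->
  ergodic_angle alpha /\ ergodic_angle (- alpha).
Proof.
move=> irr; split=> m m0; first exact: irrational_echar.
rewrite (_ : echar m (- alpha) = echar (- m) alpha); last by rewrite /echar mulrNz mulrN mulNr.
by apply: irrational_echar; rewrite ?oppr_eq0.
Qed.

End Conclusion.

Unset Implicit Arguments.

Theorem theorem4p1 (R : realType) (alpha : R) (f : R -> R) :
  0 < alpha -> (forall q : rat, alpha != ratr q) ->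
  (forall x : R, (@unit_ico R) x -> 0 <= f x) ->
  (exists M : R, forall x : R, (@unit_ico R) x -> f x <= M) ->
  lebesgue_measurable_fun (@unit_ico R) f ->
  {ae @leb R, forall y : R, (@unit_ico R) y ->
      has_autocorrelation (mu_y f alpha y) (Xi f alpha) /\
      is_diffraction (Xi f alpha) (fun m => cabs2 (fhat f m)) (fun m => m%:~R * alpha)}
  /\
  (riemann_integrable f 0 1 ->
   forall y : R, (@unit_ico R) y ->
      has_autocorrelation (mu_y f alpha y) (Xi f alpha) /\
      is_diffraction (Xi f alpha) (fun m => cabs2 (fhat f m)) (fun m => m%:~R * alpha)).
Proof.
move=> _ irr f0 [M fM] mf.
have [ea eNa] := ergodic_angle_irrational irr.
have fb x : unit_ico x -> `|f x| <= M.
  by move=> Ux; rewrite ger0_norm; [exact: fM|exact: f0].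
have bF := bmp_frac mf fb; set F := fun x => _ in bF.
have FM x : `|F x| <= M by apply: fb; exact: frac_ico.
(* The diffraction statement concerns [Xi] alone and not the starting point, so both halves of the
   theorem share it. *)
have diff := Xi_diffraction alpha bF.
pose g (z : int) x := F x * F (x - z%:~R * alpha).
have bg z : bmp (g z) by apply: bmpM => //; exact: bmp_shift.
have XiE z : Xi f alpha z = Rint01 (g z).
  by rewrite (Xi_mean f alpha); apply: eq_I01 => x _; rewrite mulrC.
have auto y : (forall z, avg alpha (g z) y @ \oo --> Rint01 (g z) /\
      avg (- alpha) (g z) y @ \oo --> Rint01 (g z)) ->
    has_autocorrelation (mu_y f alpha y) (Xi f alpha).
  by move=> H z; have [h1 h2] := H z; rewrite XiE; exact: (autoc_cvg FM h1 h2).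
split.
  (* For each integer z, two null sets are discarded, one for each direction of the orbit; countably
     many in all, so one null set serves every z. *)
  apply: ae_imp (ae_forall_int (fun z => ae_and (birkhoff_ae ea (bg z)) (birkhoff_ae eNa (bg z)))).
  by move=> y H Uy; split=> //; apply: auto => z; have [h1 h2] := H z; split; [exact: h1|exact: h2].
move=> RI y Uy; split=> //; apply: auto => z.
have tF : trig_dom F by exact: (trig_dom_riemann fb bF RI).
have tg : trig_dom (g z) by apply: trig_domM => //; exact: trig_dom_shift.
by split; exact: trig_dom_avg.
Qed.
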